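(* Let $q=2$ and let $m\ge 7$ be an integer such that $3\mid 2^m-1$ and $m\notin\{8,10,12,14,16,18\}$. Then for every $a\in\mathbb{F}_2$ and for $b=1$ (the only element of $\mathbb{F}_2^*$), there exists a $3$-primitive $1$-normal element $\xi\in\mathbb{F}_{2^m}$ over $\mathbb{F}_2$ such that $\mathrm{Tr}_{\mathbb{F}_{2^m}/\mathbb{F}_2}(\xi^{-1})=ab^{-1}$ and $\mathrm{N}_{\mathbb{F}_{2^m}/\mathbb{F}_2}(\xi)=b$.
   Context: An element $\xi\in\mathbb{F}_{2^m}^*$ is $3$-primitive (where $3\mid 2^m-1$) if its multiplicative order is $(2^m-1)/3$. It is $1$-normal over $\mathbb{F}_2$ if the $\mathbb{F}_2$-linear span of $\xi,\xi^2,\xi^{4},\ldots,\xi^{2^{m-1}}$ has dimension $m-1$ over $\mathbb{F}_2$. $\mathrm{Tr}_{\mathbb{F}_{2^m}/\mathbb{F}_2}$ and $\mathrm{N}_{\mathbb{F}_{2^m}/\mathbb{F}_2}$ are the trace and norm from $\mathbb{F}_{2^m}$ to $\mathbb{F}_2$. *)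

(* Defs.v *)
From mathcomp Require Import all_boot all_order all_algebra all_fingroup all_field.

Set Implicit Arguments.
Unset Strict Implicit.
Unset Printing Implicit Defensive.

Import GRing.Theory.
Local Open Scope ring_scope.

(* A finite extension L of F = F_q with \dim {:L} = n is a copy of F_{q^n}.   *)
(* It is a splittingFieldType so that galTrace and galNorm, the sum and the   *)
(* product over 'Gal({:L} / 1), are available; every finite extension of a    *)
(* finite field carries this structure (FinSplittingFieldType).               *)

(* n.-primitive_root x says that x has multiplicative order exactly n. *)
Definition r_primitive (F : finFieldType) (L : splittingFieldType F)
    (r : nat) (x : L) : bool :=
  (r %| #|F| ^ \dim {:L} - 1)%N &&
  ((#|F| ^ \dim {:L} - 1) %/ r)%N.-primitive_root x.

Definition conjugates (F : finFieldType) (L : splittingFieldType F)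
    (x : L) : seq L :=
  [seq x ^+ (#|F| ^ i) | i <- iota 0 (\dim {:L})].

(* The span has dimension n - k, written so as to avoid truncated subtraction. *)
Definition k_normal (F : finFieldType) (L : splittingFieldType F)
    (k : nat) (x : L) : bool :=
  (\dim <<conjugates x>>%VS + k == \dim {:L})%N.

Definition Tr (F : finFieldType) (L : splittingFieldType F) (x : L) : L :=
  galTrace 1%VS {:L}%VS x.

Definition Nm (F : finFieldType) (L : splittingFieldType F) (x : L) : L :=
  galNorm 1%VS {:L}%VS x.

(* Main.v *)
Require Import Defs.
From Stdlib Require Import NArith.
From mathcomp Require Import all_boot all_order all_algebra all_fingroup.
From mathcomp Require Import all_solvable all_field qpoly.
From mathcomp Require Import ring lra zify.

Set Implicit Arguments.
Unset Strict Implicit.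
Unset Printing Implicit Defensive.

Import Order.TTheory GRing.Theory Num.Theory.
Local Open Scope ring_scope.

(** Write Q = 2^m, N = (Q - 1) / 3 and h = 1 + X + ... + X^(m-1), and let F_2[X]
    act on the field with X acting as the Frobenius map.  As 3 divides Q - 1, m is
    even, hence m >= 20.  The norm of a nonzero element is 1.  An element x is
    1-normal when its trace h x is 0 and (h / f) x is nonzero for every irreducible
    factor f of h.  So one wants x of order exactly N satisfying these conditions
    and Tr(1/x) = a.

    The analytic input is a bound for the real sums
      S(al, be) = sum over x^n = 1 of (-1)^Tr(al x + be / x),   n | Q - 1.
    The equations x + y = z + w, 1/x + 1/y = 1/z + 1/w only have the obvious
    solutions, so the fourth moment of S over all (al, be) is at most 3 Q^2 n^2;
    and S takes the same value at the n pairs (al t, be / t), t^n = 1.  Hence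
    S^4 <= 3 Q^2 n as soon as (al, be) is not (0, 0) (ksum4_le).  This argument of
    Kloosterman loses against the bound of Weil but is elementary, and applying it to
    subgroups instead of multiplicative characters keeps all sums real.

    Normality costs only linear conditions: for each irreducible f | h there is an
    al_f such that Tr(al_f x) = 1 forces (h / f) x to be nonzero, and the al_f
    together with 1 are linearly independent (irreducible_functionals).  The x
    with x^n = 1 meeting these conditions and Tr(1/x) = a can be counted up to the
    bound for S (cond_count_bound).  The order of x is then handled by a sieve over
    the primes p of N, by inclusion-exclusion on a set P of small primes and by the
    union bound on the others; restricting to the subgroup of index p divides the
    main term by p and the error by p^(1/4) (sieve_prim_root).

    There remains an inequality between m, the number of irreducible factors of
    h and the primes of N (sieve_inequality).  It follows from crude estimates for
    m >= 768 (large_sieve_inequality) and from a computation for smaller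
    m >= 32 other than 36, 42 and 54 (middle_degrees_check).  For the nine degrees
    left over there are explicit polynomials, one for each a, whose roots have all
    the required properties (certificates). *)

(** * The absolute trace and its additive character *)

Section AbsoluteTrace.

Variables (K : finFieldType) (m : nat).
Hypothesis cardK : #|K| = (2 ^ m)%N.

Lemma card_pow2_pchar : 2%N \in [pchar K].
Proof. exact: card_finPcharP cardK isT. Qed.

Let char2 := card_pow2_pchar.

Lemma card_pow2_exp_gt0 : (0 < m)%N.
Proof.
have := finNzRing_gt1 K; rewrite cardK.
by case: (m).
Qed.

Lemma expf_card_pow2 (x : K) : x ^+ (2 ^ m) = x.
Proof. by rewrite -cardK expf_card. Qed.

Lemma oppx2 (x : K) : - x = x.
Proof. exact: oppr_pchar2. Qed.

Lemma addxx2 (x : K) : x + x = 0.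
Proof. exact: addrr_pchar2. Qed.

Lemma expD2 (x y : K) i : (x + y) ^+ (2 ^ i) = x ^+ (2 ^ i) + y ^+ (2 ^ i).
Proof. by rewrite exprDn_pchar // pnatX pnatE // char2. Qed.

Definition tr (x : K) : K := \sum_(i < m) x ^+ (2 ^ i).

Lemma trD x y : tr (x + y) = tr x + tr y.
Proof. by rewrite /tr -big_split; apply: eq_bigr => i _; apply: expD2. Qed.

Lemma tr0 : tr 0 = 0.
Proof. by rewrite /tr big1 // => i _; rewrite expr0n expn_eq0. Qed.

Lemma tr_sqr x : tr x ^+ 2 = tr (x ^+ 2).
Proof.
have := expD2; rewrite /tr => D.
rewrite (big_morph (fun y : K => y ^+ 2) (id1 := 0) (op1 := +%R)).
- by apply: eq_bigr => i _; rewrite -!exprM mulnC.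
- by move=> u v; apply: (D u v 1%N).
- by rewrite expr0n.
Qed.

Lemma tr_frob x : tr (x ^+ 2) = tr x.
Proof.
rewrite /tr -(prednK card_pow2_exp_gt0) big_ord_recr [in RHS]big_ord_recl /= addrC.
congr (_ + _).
  by rewrite -exprM -expnS prednK ?card_pow2_exp_gt0 // expf_card_pow2 expr1.
by apply: eq_bigr => i _; rewrite -exprM -expnS.
Qed.

Lemma tr_frobX x i : tr (x ^+ (2 ^ i)) = tr x.
Proof. by elim: i => [|i IH]; rewrite ?expr1 // expnSr exprM tr_frob. Qed.

Lemma tr_01 x : (tr x == 0) || (tr x == 1).
Proof.
have: tr x * (tr x - 1) == 0 by rewrite mulrBr mulr1 -expr2 tr_sqr tr_frob subrr.
by rewrite mulf_eq0 subr_eq0.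
Qed.

Lemma tr_neq0 x : (tr x != 0) = (tr x == 1).
Proof. by case/orP: (tr_01 x) => /eqP->; rewrite ?eqxx ?oner_eq0 // eq_sym oner_eq0. Qed.

(** The trace is a polynomial of degree 2^(m-1) and so cannot vanish at
    all 2^m points. *)
Lemma tr_surj : exists x, tr x = 1.
Proof.
pose p : {poly K} := \sum_(i < m) 'X^(2 ^ i).
have p_hor x : p.[x] = tr x.
  by rewrite /p horner_sum; apply: eq_bigr => i _; rewrite hornerXn.
case: (boolP [exists x, tr x == 1]) => [/existsP[x /eqP]|]; first by exists x.
rewrite negb_exists => /forallP H.
have pN0 : p != 0.
  apply/eqP => /polyP/(_ 1%N)/eqP.
  rewrite coef0 /p coef_sum -(prednK card_pow2_exp_gt0) big_ord_recl coefXn expn0 /=.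
  rewrite big1 ?addr0 ?oner_eq0 // => i _.
  by rewrite coefXn /bump /= add1n expnS; case: eqP => // E; exfalso; lia.
have := max_poly_roots (rs := enum K) pN0.
have -> : all (root p) (enum K).
  by apply/allP => x _; rewrite rootE p_hor; move: (tr_neq0 x) (H x) => <-; rewrite negbK.
rewrite enum_uniq => /(_ isT isT).
rewrite -cardE cardK => lt_p.
have : (size p <= (2 ^ m.-1).+1)%N.
  apply: leq_trans (size_sum _ _ _) _; apply/bigmax_leqP => i _.
  rewrite size_polyXn ltnS leq_exp2l //.
  by rewrite -ltnS prednK ?card_pow2_exp_gt0.
rewrite leqNgt => /negP[]; apply: leq_ltn_trans lt_p.
rewrite -[in X in (_ <= X)%N](prednK card_pow2_exp_gt0) expnS mul2n -addnn -addn1.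
by rewrite leq_add2l expn_gt0.
Qed.

(** The nontrivial additive character; it is real since the characteristic is 2. *)
Definition sgn_tr (x : K) : rat := if tr x == 0 then 1 else -1.
Local Notation e := sgn_tr.

Lemma sgn_trD x y : e (x + y) = e x * e y.
Proof.
rewrite /e trD; case/orP: (tr_01 x) => /eqP->; case/orP: (tr_01 y) => /eqP->;
  by rewrite ?addxx2 ?add0r ?addr0 ?eqxx ?oner_eq0 ?mulr1 ?mul1r // mulrNN mulr1.
Qed.

Lemma sgn_tr0 : e 0 = 1.
Proof. by rewrite /e tr0 eqxx. Qed.

Lemma sum_sgn_tr (al : K) :
  \sum_x e (al * x) = if al == 0 then (2 ^ m)%:R else 0.
Proof.
case: eqP => [->|/eqP al0].
  under eq_bigr => x _ do rewrite mul0r sgn_tr0.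
  by rewrite sumr_const cardK.
have [y y1] := tr_surj.
have: \sum_x e (al * x) = - \sum_x e (al * x); last by lra.
rewrite {1}(reindex_inj (addIr (al^-1 * y))) -sumrN.
apply: eq_bigr => x _; rewrite mulrDr mulrA mulfV // mul1r sgn_trD.
by rewrite {2}/e y1 oner_eq0 mulrN1.
Qed.

End AbsoluteTrace.

(** * Kloosterman sums over subgroups *)

Section KloostermanSums.

Variables (K : finFieldType) (m : nat).
Hypothesis cardK : #|K| = (2 ^ m)%N.

Local Notation e := (@sgn_tr K m).
Local Notation Q := ((2 ^ m)%:R : rat).

Definition unity_roots (n : nat) : {set K} := [set x | x ^+ n == 1].
Local Notation H := unity_roots.

Lemma unity_roots_neq0 n x : (0 < n)%N -> x \in H n -> x != 0.
Proof.
move=> n_gt0; rewrite inE; apply: contraTneq => ->.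
by rewrite expr0n eqn0Ngt n_gt0 eq_sym oner_eq0.
Qed.

(** The multiplicative group is cyclic. *)
Lemma exists_prim_root n : (n %| 2 ^ m - 1)%N -> exists w : K, n.-primitive_root w.
Proof.
move=> n_dv; have gt1 := finNzRing_gt1 K; rewrite cardK in gt1.
have q_gt0 : (0 < 2 ^ m - 1)%N by rewrite subn_gt0.
have/hasP[z _ zP]: has (2 ^ m - 1).-primitive_root (rem 0 (enum K)).
  apply: has_prim_root => //.
  - apply/allP => x; rewrite mem_rem_uniq ?enum_uniq // inE => /andP[x0 _].
    rewrite unity_rootE -(inj_eq (mulfI x0)) mulr1 -exprS.
    by rewrite -addn1 subnK ?(expf_card_pow2 cardK) // ltnW.
  - by rewrite rem_uniq ?enum_uniq.
  - by rewrite size_rem ?mem_enum // -cardE cardK subn1.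
by exists (z ^+ ((2 ^ m - 1) %/ n)%N); apply: dvdn_prim_root.
Qed.

Lemma card_unity_roots n : (n %| 2 ^ m - 1)%N -> #|H n| = n.
Proof.
move=> n_dv; have [w wP] := exists_prim_root n_dv.
have inj : injective (fun i : 'I_n => w ^+ i).
  move=> i j /eqP; rewrite (eq_prim_root_expr wP) !modn_small // => /eqP.
  exact: val_inj.
rewrite -[RHS]card_ord -(card_imset _ inj); congr #|pred_of_set _|.
apply/setP => x; rewrite inE; apply/eqP/imsetP => [/(prim_rootP wP)[i ->]|[i _ ->]].
  by exists i.
by rewrite exprAC (prim_expr_order wP) expr1n.
Qed.

(** Expanding the square and summing over q kills every pair but those with
    equal values of s and of t, by orthogonality in each coordinate. *)
Lemma parseval_sgn_tr (I : finType) (P : {set I}) (s t : I -> K) :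
  \sum_(q : K * K) (\sum_(p in P) e (q.1 * s p + q.2 * t p)) ^+ 2 =
  Q ^+ 2 * #|[set u in setX P P | (s u.1 == s u.2) && (t u.1 == t u.2)]|%:R.
Proof.
have eD := sgn_trD cardK.
transitivity (\sum_(u in setX P P)
    \sum_(q : K * K) e (q.1 * (s u.1 + s u.2)) * e (q.2 * (t u.1 + t u.2))).
  rewrite exchange_big; apply: eq_bigr => q _ /=.
  rewrite expr2 big_distrlr /= pair_big_dep /=.
  apply: eq_big => [[x y]|[x y] _]; first by rewrite in_setX.
  by rewrite -!eD /=; congr e; ring.
transitivity (\sum_(u in setX P P)
  if (s u.1 == s u.2) && (t u.1 == t u.2) then Q ^+ 2 else 0); last first.
  rewrite -big_mkcondr /= sumr_const mulrC mulr_natl.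
  by congr (_ *+ _); apply: eq_card => u; rewrite [in RHS]inE.
apply: eq_bigr => u _.
rewrite -(pair_bigA _ (fun x y => e (x * _) * e (y * _))) /=.
rewrite -big_distrlr /=.
have sumE v w : \sum_i e (i * (v + w)) = if v == w then Q else 0.
  under eq_bigr => i _ do rewrite mulrC.
  by rewrite (sum_sgn_tr cardK) addr_eq0 (oppx2 cardK).
by rewrite !sumE; case: eqP; case: eqP; rewrite ?mul0r ?mulr0.
Qed.

Definition ksum n (al be : K) : rat := \sum_(x in H n) e (al * x + be / x).

(** The square of a sum is a sum over pairs, so parseval_sgn_tr counts the
    solutions of x + y = z + w, 1/x + 1/y = 1/z + 1/w.  There are three families
    of size n^2. *)
Lemma ksum4_total n : (n %| 2 ^ m - 1)%N -> (0 < n)%N ->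
  \sum_(q : K * K) ksum n q.1 q.2 ^+ 4 <= 3 * Q ^+ 2 * n%:R ^+ 2.
Proof.
move=> n_dv n_gt0.
have eD := sgn_trD cardK.
pose s (p : K * K) := p.1 + p.2; pose t (p : K * K) := p.1^-1 + p.2^-1.
have -> : \sum_(q : K * K) ksum n q.1 q.2 ^+ 4 =
    \sum_(q : K * K) (\sum_(p in setX (H n) (H n)) e (q.1 * s p + q.2 * t p)) ^+ 2.
  apply: eq_bigr => q _; rewrite -[4%N]/(2 * 2)%N exprM; congr (_ ^+ 2).
  rewrite expr2 big_distrlr /= pair_big_dep /=.
  apply: eq_big => [[x y]|[x y] _]; first by rewrite in_setX.
  by rewrite -eD /=; congr e; rewrite /s /t /=; ring.
have Q2_gt0 : 0 < Q ^+ 2 by rewrite exprn_gt0 // ltr0n expn_gt0.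
rewrite parseval_sgn_tr [3 * _]mulrC -[leRHS]mulrA (ler_pM2l Q2_gt0).
set A := [set _ in _ | _].
pose HH := setX (H n) (H n).
have sub : A \subset [set (p, p) | p in HH] :|: [set (p, (p.2, p.1)) | p in HH]
    :|: [set ((p.1, p.1), (p.2, p.2)) | p in HH].
  apply/subsetP => -[[x y] [z w]]; rewrite !inE /s /t /=.
  case/andP=> /andP[/andP[xH yH] /andP[zH wH]] /andP[/eqP sE /eqP tE].
  have x0 : x != 0 by apply: (@unity_roots_neq0 n); rewrite ?inE.
  have y0 : y != 0 by apply: (@unity_roots_neq0 n); rewrite ?inE.
  have z0 : z != 0 by apply: (@unity_roots_neq0 n); rewrite ?inE.
  have w0 : w != 0 by apply: (@unity_roots_neq0 n); rewrite ?inE.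
  have [s0|s0] := eqVneq (x + y) 0.
    have yE : y = x by move/eqP: s0; rewrite addr_eq0 (oppx2 cardK) => /eqP.
    have wE : w = z.
      by move/eqP: s0; rewrite sE addr_eq0 (oppx2 cardK) => /eqP.
    apply/orP; right; apply/imsetP; exists (x, z); last by rewrite yE wE.
    by rewrite !inE xH zH.
  (* Equal nonzero sum and equal sum of inverses give equal product, so that
     {x, y} and {z, w} are the roots of the same quadratic polynomial. *)
  have xy : x * y = z * w.
    have E1 : (x + y) / (x * y) = (x + y) / (z * w).
      have -> : (x + y) / (x * y) = x^-1 + y^-1 by field; rewrite x0 y0.
      by rewrite tE sE; field; rewrite z0 w0.
    by move/(mulfI s0)/invr_inj: E1.
  have: (z - x) * (z - y) = 0.
    have -> : (z - x) * (z - y) = z * z - z * (x + y) + x * y by ring.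
    by rewrite sE xy; ring.
  move/eqP; rewrite mulf_eq0 !subr_eq0 => /orP[] /eqP zE.
    have wE : w = y by apply: (addrI z); rewrite -sE zE.
    apply/orP; left; apply/orP; left; apply/imsetP; exists (x, y); last by rewrite zE wE.
    by rewrite !inE xH yH.
  have wE : w = x by apply: (addrI z); rewrite -sE zE addrC.
  apply/orP; left; apply/orP; right; apply/imsetP; exists (x, y); last by rewrite zE wE.
  by rewrite !inE xH yH.
have cHH : #|HH| = (n ^ 2)%N by rewrite cardsX card_unity_roots // -mulnn.
rewrite -natrX -natrM ler_nat.
apply: leq_trans (subset_leq_card sub) _.
apply: leq_trans (leq_card_setU _ _) _.
rewrite mulSn mul2n -addnn addnA; apply: leq_add; last first.
  by apply: leq_trans (leq_imset_card _ _) _; rewrite cHH.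
apply: leq_trans (leq_card_setU _ _) _.
by apply: leq_add; apply: leq_trans (leq_imset_card _ _) _; rewrite cHH.
Qed.

Lemma ksum_scale n (al be t : K) : (0 < n)%N -> t \in H n ->
  ksum n (al * t) (be / t) = ksum n al be.
Proof.
move=> n_gt0 tH; have t0 := unity_roots_neq0 n_gt0 tH.
rewrite /ksum [RHS](reindex_inj (mulIf t0)) /=.
apply: eq_big => [x|x _].
  by rewrite !inE exprMn; move: tH; rewrite inE => /eqP->; rewrite mulr1.
by congr e; rewrite invfM; ring.
Qed.

(** The n pairs (al t, be / t) are distinct and contribute equally to the
    fourth moment, which bounds each single value. *)
Lemma ksum4_le n (al be : K) : (n %| 2 ^ m - 1)%N -> (0 < n)%N ->
  (al, be) != (0, 0) -> ksum n al be ^+ 4 <= 3 * Q ^+ 2 * n%:R.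
Proof.
move=> n_dv n_gt0 nz.
have n0 : 0 < n%:R :> rat by rewrite ltr0n.
rewrite -(ler_pM2r n0) -[leRHS]mulrA -[n%:R * n%:R]expr2.
apply: le_trans (ksum4_total n_dv n_gt0).
pose f t : K * K := (al * t, be / t).
have f_inj : {in H n &, injective f}.
  move=> t u tH uH; rewrite /f => -[E1 E2].
  move: nz; rewrite xpair_eqE negb_and => /orP[] nz.
    exact: (mulfI nz).
  by apply: invr_inj; apply: (mulfI nz).
have -> : ksum n al be ^+ 4 * n%:R = \sum_(q in f @: H n) ksum n q.1 q.2 ^+ 4.
  rewrite big_imset //=.
  rewrite (eq_bigr (fun=> ksum n al be ^+ 4)); last by move=> t tH; rewrite ksum_scale.
  by rewrite sumr_const card_unity_roots // mulr_natr.
rewrite [leRHS](bigID (mem (f @: H n))) /= lerDl.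
by apply: sumr_ge0 => q _; rewrite exprn_even_ge0.
Qed.

End KloostermanSums.

(** * Counting under affine conditions *)

Section AffineCount.

Variables (K : finFieldType) (m : nat).
Hypothesis cardK : #|K| = (2 ^ m)%N.

Local Notation e := (@sgn_tr K m).
Local Notation H := (unity_roots K).

(** The F_2-span of l, with repetitions; sums_free is then linear independence
    over F_2. *)
Fixpoint subset_sums (l : seq K) : seq K :=
  if l is a :: l' then subset_sums l' ++ [seq a + b | b <- subset_sums l']
  else [:: 0].

Fixpoint sums_free (l : seq K) : bool :=
  if l is a :: l' then (a \notin subset_sums l') && sums_free l' else true.

Definition tr_conds (l : seq (K * bool)) (x : K) : bool :=
  all (fun p : K * bool => tr m (p.1 * x) == p.2%:R) l.

(** As (1 + (-1)^c (-1)^Tr(u)) / 2 is the indicator of Tr(u) = c, this is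
    2^k times the indicator of the conditions l. *)
Definition tr_conds_weight (l : seq (K * bool)) (x : K) : rat :=
  \prod_(p <- l) (1 + (-1) ^+ p.2 * e (p.1 * x)).

Lemma one_add_sgn_tr (c : bool) x :
  1 + (-1) ^+ c * e x = if tr m x == c%:R then 2 else 0.
Proof.
rewrite /sgn_tr; case/orP: (tr_01 cardK x) => /eqP->; case: c => /=;
  rewrite ?eqxx ?oner_eq0 ?[0 == 1]eq_sym ?oner_eq0 ?expr1 ?expr0; lra.
Qed.

Lemma tr_conds_weightE l x :
  tr_conds_weight l x = if tr_conds l x then 2 ^+ size l else 0.
Proof.
rewrite /tr_conds_weight; elim: l => [|p l IH]; first by rewrite big_nil expr0.
rewrite big_cons IH one_add_sgn_tr /=.
by case: eqP => _ /=; case: (tr_conds l x); rewrite ?mulr0 ?mul0r ?exprS.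
Qed.

Definition twisted_ksum n l (al be : K) : rat :=
  \sum_(x in H n) e (al * x + be / x) * tr_conds_weight l x.

Lemma twisted_ksum_cons n p l al be :
  twisted_ksum n (p :: l) al be =
  twisted_ksum n l al be + (-1) ^+ p.2 * twisted_ksum n l (al + p.1) be.
Proof.
rewrite /twisted_ksum mulr_sumr -big_split; apply: eq_bigr => x _ /=.
rewrite /tr_conds_weight big_cons.
have -> : (al + p.1) * x + be / x = (al * x + be / x) + p.1 * x by ring.
rewrite !(sgn_trD cardK); ring.
Qed.

Variables (n : nat) (E : rat).
Hypothesis ksum_le : forall al be : K, (al, be) != (0, 0) -> `|ksum m n al be| <= E.

Lemma twisted_ksum_nil al be : twisted_ksum n [::] al be = ksum m n al be.
Proof.
by apply: eq_bigr => x _; rewrite /tr_conds_weight big_nil mulr1.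
Qed.

(** By twisted_ksum_cons this is a sum of 2^k values of ksum, none of them at
    (0, 0). *)
Lemma twisted_ksum_le l al be :
    (be != 0) || (al \notin subset_sums (map fst l)) ->
  `|twisted_ksum n l al be| <= 2 ^+ size l * E.
Proof.
elim: l al => [|p l IH] al /= cond.
  rewrite twisted_ksum_nil expr0 mul1r ksum_le // xpair_eqE negb_and orbC.
  by move: cond; rewrite inE.
rewrite twisted_ksum_cons exprS -mulrA mulr_natl mulr2n.
apply: le_trans (ler_normD _ _) _; apply: lerD.
  apply: IH; case: (be != 0) cond => //=; apply: contra => alP.
  by rewrite mem_cat alP.
rewrite normrM normr_sign mul1r; apply: IH.
case: (be != 0) cond => //=; apply: contra => alP.
rewrite mem_cat; apply/orP; right; apply/mapP; exists (al + p.1) => //.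
by rewrite addrCA (addxx2 cardK) addr0.
Qed.

(** Among the 2^k values of ksum exactly one, by independence, is at (0, 0),
    where ksum equals n. *)
Lemma twisted_ksum_main l : (n %| 2 ^ m - 1)%N -> sums_free (map fst l) ->
  `|twisted_ksum n l 0 0 - n%:R| <= (2 ^+ size l - 1) * E.
Proof.
move=> n_dv; elim: l => [|p l IH] /= => [_|/andP[pl fl]].
  rewrite twisted_ksum_nil expr0 subrr mul0r /ksum.
  under eq_bigr => x _ do rewrite !mul0r addr0 sgn_tr0.
  by rewrite sumr_const (card_unity_roots cardK n_dv) subrr normr0.
rewrite twisted_ksum_cons add0r addrAC exprS.
have -> : (2 * 2 ^+ size l - 1) * E = (2 ^+ size l - 1) * E + 2 ^+ size l * E by ring.
apply: le_trans (ler_normD _ _) _; apply: lerD; first exact: IH.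
by rewrite normrM normr_sign mul1r twisted_ksum_le // pl orbT.
Qed.

Definition cond_count (l : seq (K * bool)) (c : bool) : nat :=
  #|[set x in H n | tr_conds l x && (tr m x^-1 == c%:R)]|.

Lemma cond_count_bound l c : (n %| 2 ^ m - 1)%N -> sums_free (map fst l) ->
  `|(cond_count l c)%:R - n%:R / 2 ^+ (size l).+1| <= E.
Proof.
move=> n_dv l_free.
have E_ge0 : 0 <= E.
  by apply: le_trans (ksum_le (al := 0) (be := 1) _); rewrite // xpair_eqE oner_eq0 andbF.
have p2 : 0 < 2 ^+ (size l).+1 :> rat by rewrite exprn_gt0.
have cntE : (cond_count l c)%:R * 2 ^+ (size l).+1 =
    twisted_ksum n l 0 0 + (-1) ^+ c * twisted_ksum n l 0 1.
  rewrite /twisted_ksum mulr_sumr -big_split /=.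
  transitivity (\sum_(x in H n) if tr_conds l x && (tr m x^-1 == c%:R)
                                then 2 ^+ (size l).+1 else 0 : rat).
    rewrite -big_mkcondr /= sumr_const mulr_natl.
    by congr (_ *+ _); apply: eq_card => x; rewrite [in LHS]inE.
  apply: eq_bigr => x _.
  rewrite !mul0r addr0 add0r mul1r sgn_tr0 mulrA -mulrDl one_add_sgn_tr tr_conds_weightE.
  by case: eqP => _; case: (tr_conds l x); rewrite /= ?mulr0 ?mul0r // exprS.
have -> : (cond_count l c)%:R - n%:R / 2 ^+ (size l).+1 =
    (twisted_ksum n l 0 0 - n%:R + (-1) ^+ c * twisted_ksum n l 0 1) / 2 ^+ (size l).+1.
  by rewrite addrAC -cntE mulrBl mulfK ?lt0r_neq0.
rewrite normrM normfV (gtr0_norm p2) ler_pdivrMr //.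
apply: le_trans (ler_normD _ _) _.
have le1 := twisted_ksum_main n_dv l_free.
have le2 : `|twisted_ksum n l 0 1| <= 2 ^+ size l * E.
  by apply: twisted_ksum_le; rewrite oner_eq0.
rewrite normrM normr_sign mul1r exprS.
lra.
Qed.

(** A z that is orthogonal to l but not to a shows that a is outside the span
    of l; this is how independence is obtained. *)
Lemma subset_sums_tr0 l y z : (forall b, b \in l -> tr m (b * z) = 0) ->
  y \in subset_sums l -> tr m (y * z) = 0.
Proof.
elim: l y => [|a l IH] y H0 /=.
  by rewrite inE => /eqP->; rewrite mul0r tr0.
have H0l b : b \in l -> tr m (b * z) = 0 by move=> bl; apply: H0; rewrite inE bl orbT.
rewrite mem_cat => /orP[/(IH _ H0l)//|/mapP[b bl ->]].
by rewrite mulrDl (trD cardK) (IH _ H0l bl) addr0 H0 // mem_head.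
Qed.

End AffineCount.

(** * The sieve for the order *)

(** If the order d of x were a proper divisor of N, some prime p would divide
    N / d, and then d would divide N / p. *)
Lemma prim_root_of_primes (R : nzRingType) (x : R) N : (0 < N)%N -> x ^+ N = 1 ->
  (forall p, p \in primes N -> x ^+ (N %/ p) != 1) -> N.-primitive_root x.
Proof.
move=> N_gt0 xN1 xp; have [d dP d_dv] := prim_order_exists N_gt0 xN1.
have d_gt0 := dvdn_gt0 N_gt0 d_dv.
case: (ltngtP (N %/ d) 1) => [||E1].
- by rewrite ltnNge divn_gt0 // dvdn_leq.
- move=> gt1; have p_pr := pdiv_prime gt1.
  have pd_dv : (pdiv (N %/ d) * d %| N)%N.
    by rewrite -[X in (_ %| X)%N](divnK d_dv) dvdn_pmul2r // pdiv_dvd.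
  have p_dv : (pdiv (N %/ d) %| N)%N by apply: dvdn_trans pd_dv; apply: dvdn_mulr.
  have := xp (pdiv (N %/ d)); rewrite mem_primes p_pr N_gt0 p_dv => /(_ isT).
  rewrite -(prim_order_dvd dP) => /negP[].
  by rewrite dvdn_divRL // mulnC.
- by rewrite -(divnK d_dv) E1 mul1n.
Qed.

Lemma expr_coprime_eq1 (R : nzRingType) (x : R) a b c : (0 < a)%N -> coprime a b ->
  x ^+ (a * c) = 1 -> x ^+ (b * c) = 1 -> x ^+ c = 1.
Proof.
move=> a_gt0 co xa xb; case: (egcdnP b a_gt0) => u v E _.
have: x ^+ (u * a * c) = 1 by rewrite -mulnA mulnC exprM xa expr1n.
rewrite E (eqP co) mulnDl mul1n exprD -mulnA mulnC exprM xb expr1n.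
by rewrite mul1r.
Qed.

Lemma mem_bigcup_seq (I : Type) (T : finType) (x : T) (s : seq I) (A : I -> {set T}) :
  (x \in \bigcup_(i <- s) A i) = has (fun i => x \in A i) s.
Proof. by elim: s => [|i s IH]; rewrite ?big_nil ?inE // big_cons inE IH. Qed.

Section PrimeSieve.

Variables (K : finFieldType) (m : nat).
Hypothesis cardK : #|K| = (2 ^ m)%N.
Local Notation H := (unity_roots K).
Local Notation Q := ((2 ^ m)%:R : rat).

Variables (N : nat) (l : seq (K * bool)) (c : bool) (w : nat -> rat) (E : rat).
Hypotheses (N_gt0 : (0 < N)%N) (N_dv : (N %| 2 ^ m - 1)%N).
Hypothesis l_free : sums_free (map fst l).
Hypothesis w_ge0 : forall p, 0 <= w p.
Hypothesis w_ge : forall p, p \in primes N -> 1 <= w p ^+ 4 * p%:R.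
Hypotheses (E_ge0 : 0 <= E) (E_ge : 3 * Q ^+ 2 * N%:R <= E ^+ 4).

Lemma prod_primes_dvd (T : seq nat) : uniq T -> all (mem (primes N)) T ->
  ((\prod_(q <- T) q) %| N)%N /\
  forall p, p \in primes N -> p \notin T -> coprime p (\prod_(q <- T) q)%N.
Proof.
elim: T => [|q T IH] /=; first by rewrite big_nil dvd1n; split=> // p; rewrite coprimen1.
case/andP=> qT T_uniq /andP[qN TN]; have [T_dv T_co] := IH T_uniq TN.
have [q_pr q_dv] : prime q /\ (q %| N)%N by move: qN; rewrite /= mem_primes => /and3P[].
split; rewrite big_cons; first by rewrite Gauss_dvd ?q_dv ?T_dv // T_co.
move=> p pN; rewrite inE negb_or => /andP[pq pT]; rewrite coprimeMr T_co // andbT.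
by move: pN; rewrite mem_primes => /andP[p_pr _]; rewrite prime_coprime // dvdn_prime2.
Qed.

(** The state of the inclusion-exclusion: P holds the primes to be excluded, T
    those whose condition x^(N/q) = 1 has been imposed. *)
Definition sieved (P T : seq nat) : {set K} :=
  [set x in H (N %/ (\prod_(q <- T) q)%N) |
    [&& tr_conds m l x, tr m x^-1 == c%:R & all (fun p => x ^+ (N %/ p) != 1) P]].

Lemma sieved_cons p P T : uniq (p :: T) -> all (mem (primes N)) (p :: T) ->
  #|sieved P T| = (#|sieved (p :: P) T| + #|sieved P (p :: T)|)%N.
Proof.
move=> /=/andP[pT T_uniq] /andP[pN TN]; have [D_dv /(_ _ pN pT) co] := prod_primes_dvd T_uniq TN.
have [pT_dv _] : ((\prod_(q <- p :: T) q) %| N)%N /\ True.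
  by split=> //; have [] := @prod_primes_dvd (p :: T); rewrite //= ?pT // pN.
have p_gt0 : (0 < p)%N.
  by move: pN; rewrite /= mem_primes => /and3P[/prime_gt0].
rewrite -(cardsID [set x | x ^+ (N %/ p) != 1] (sieved P T)).
congr (_ + _)%N; apply: eq_card => x; rewrite !inE.
  by rewrite /=; case: (_ ^+ (N %/ p) != 1); rewrite ?andbT ?andbF.
rewrite negbK /= andbC.
set D := (\prod_(q <- T) q)%N in co D_dv *; move: pT_dv; rewrite big_cons -/D => /dvdnP[M NE].
have D_gt0 : (0 < D)%N by apply: dvdn_gt0 D_dv.
have -> : (N %/ (p * D) = M)%N by rewrite NE mulnK // muln_gt0 p_gt0.
have E1 : (N %/ D = p * M)%N by rewrite NE mulnA mulnK // mulnC.
have E2 : (N %/ p = D * M)%N by rewrite NE mulnCA mulKn // mulnC.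
rewrite E1 E2.
have -> : (x ^+ M == 1) = (x ^+ (p * M) == 1) && (x ^+ (D * M) == 1).
  apply/eqP/andP => [xM|[/eqP ? /eqP ?]]; last exact: (@expr_coprime_eq1 _ _ p D).
  by rewrite ![(_ * M)%N]mulnC !exprM xM !expr1n eqxx.
by case: (x ^+ (p * M) == 1); case: (x ^+ (D * M) == 1); rewrite /= ?andbT ?andbF.
Qed.

(** The hypothesis w p >= p^(-1/4) turns the gain in ksum4_le from passing to
    a subgroup of index prod T into a product of weights. *)
Lemma ksum_sieved_le T : uniq T -> all (mem (primes N)) T ->
  forall al be : K, (al, be) != (0, 0) ->
  `|ksum m (N %/ (\prod_(q <- T) q)%N) al be| <= E * \prod_(q <- T) w q.
Proof.
move=> T_uniq TN al be nz; have [D_dv _] := prod_primes_dvd T_uniq TN.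
set D := (\prod_(q <- T) q)%N in D_dv *.
have D_gt0 : (0 < D)%N by apply: dvdn_gt0 D_dv.
have W_ge0 : 0 <= \prod_(q <- T) w q by apply: prodr_ge0.
have EW_ge0 : 0 <= E * \prod_(q <- T) w q by apply: mulr_ge0.
rewrite -(@ler_pXn2r _ 4) ?nnegrE //.
rewrite -normrX ger0_norm ?exprn_even_ge0 //.
apply: le_trans (ksum4_le cardK _ _ nz) _.
- by apply: dvdn_trans N_dv; rewrite -[X in (_ %| X)%N](divnK D_dv) dvdn_mulr.
- by rewrite divn_gt0 // dvdn_leq.
have D0 : 0 < D%:R :> rat by rewrite ltr0n.
rewrite exprMn -(ler_pM2r D0) -[leLHS]mulrA -natrM divnK // -[leRHS]mulrA.
rewrite -[leLHS]mulr1; apply: ler_pM => //.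
  by rewrite !mulr_ge0 // ?exprn_ge0 ?ler0n.
rewrite /D natr_prod -prodrXl -big_split /=.
rewrite big_seq; elim/big_ind: _ => // [x y x1 y1|q qT]; last first.
  by apply: w_ge; apply: (allP TN).
by rewrite -[1]mulr1 ler_pM.
Qed.

Local Notation M := (N%:R / 2 ^+ (size l).+1 : rat).

(** Inclusion-exclusion over P, by induction: sieved_cons removes one prime
    at a time and both the main terms and the errors multiply out. *)
Lemma sieved_bound P T : uniq (P ++ T) -> all (mem (primes N)) (P ++ T) ->
  `|#|sieved P T|%:R -
     M * \prod_(q <- T) q%:R^-1 * \prod_(p <- P) (1 - p%:R^-1)|
  <= E * \prod_(q <- T) w q * \prod_(p <- P) (1 + w p).
Proof.
elim: P T => [|p P IH] T /=.
  move=> T_uniq TN; have [D_dv _] := prod_primes_dvd T_uniq TN.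
  rewrite !big_nil !mulr1.
  have D_gt0 : (0 < \prod_(q <- T) q)%N by apply: dvdn_gt0 D_dv.
  have n_dv : (N %/ (\prod_(q <- T) q)%N %| 2 ^ m - 1)%N.
    by apply: dvdn_trans N_dv; rewrite -[X in (_ %| X)%N](divnK D_dv) dvdn_mulr.
  have := cond_count_bound cardK (ksum_sieved_le T_uniq TN) c n_dv l_free.
  have -> : cond_count m (N %/ (\prod_(q <- T) q)%N) l c = #|sieved [::] T|.
    by apply: eq_card => x; rewrite !inE /= andbT.
  suff -> : (N %/ (\prod_(q <- T) q)%N)%:R / 2 ^+ (size l).+1 =
     M * \prod_(q <- T) q%:R^-1 :> rat by [].
  rewrite mulrAC; congr (_ / _).
  have D0 : (\prod_(q <- T) q)%N%:R != 0 :> rat by rewrite pnatr_eq0 -lt0n.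
  rewrite prodfV -natr_prod; apply: (mulIf D0).
  by rewrite divfK // -natrM divnK.
case/andP; rewrite mem_cat negb_or => /andP[pP pT] PT_uniq /andP[pN PTN].
have pE : perm_eq (P ++ p :: T) (p :: P ++ T) by rewrite (perm_catCA P [:: p] T).
have pPT_uniq : uniq (P ++ p :: T).
  by rewrite (perm_uniq pE) /= mem_cat negb_or pP pT.
have pPTN : all (mem (primes N)) (P ++ p :: T).
  by rewrite (perm_all _ pE) /= pN.
have T_uniq : uniq (p :: T).
  by move: pPT_uniq; rewrite cat_uniq => /and3P[].
have TN : all (mem (primes N)) (p :: T).
  by move: pPTN; rewrite all_cat => /andP[].
have := IH T PT_uniq PTN; have := IH (p :: T) pPT_uniq pPTN.
rewrite (sieved_cons P T_uniq TN) natrD !big_cons.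
set A := #|sieved (p :: P) T|%:R; set B := #|sieved P (p :: T)|%:R.
set R := \prod_(q <- T) _; set S := \prod_(q <- P) (1 - _).
set W := \prod_(q <- T) _; set V := \prod_(q <- P) (1 + _).
move=> leB leA.
have -> : A - M * R * ((1 - p%:R^-1) * S) =
  (A + B - M * R * S) - (B - M * (p%:R^-1 * R) * S) by ring.
have -> : E * W * ((1 + w p) * V) = E * W * V + E * (w p * W) * V by ring.
by apply: le_trans (ler_normB _ _) _; apply: lerD.
Qed.

(** The elements surviving P outnumber those that some prime of R excludes. *)
Lemma sieve_prim_root P R : perm_eq (P ++ R) (primes N) ->
  E * \prod_(p <- P) (1 + w p) * (1 + \sum_(r <- R) w r) <
    M * \prod_(p <- P) (1 - p%:R^-1) * (1 - \sum_(r <- R) r%:R^-1) ->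
  exists x : K, [/\ N.-primitive_root x, tr_conds m l x & tr m x^-1 = c%:R].
Proof.
move=> PR_perm lt_main.
have PR_uniq : uniq (P ++ R) by rewrite (perm_uniq PR_perm) primes_uniq.
have PRN : all (mem (primes N)) (P ++ R).
  by rewrite (perm_all _ PR_perm); apply/allP => p pN; exact: pN.
have P_uniq : uniq P by move: PR_uniq; rewrite cat_uniq => /andP[].
have PN : all (mem (primes N)) P by move: PRN; rewrite all_cat => /andP[].
set goodP := \prod_(p <- P) (1 - _) in lt_main; set V := \prod_(p <- P) _ in lt_main.
have lower : M * goodP - E * V <= #|sieved P [::]|%:R.
  have := @sieved_bound P [::]; rewrite cats0 !big_nil !mulr1 => /(_ P_uniq PN).
  by rewrite ler_distl => /andP[].
have upper r : r \in R -> #|sieved P [:: r]|%:R <= M * goodP * r%:R^-1 + E * V * w r.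
  move=> rR.
  have rN : r \in primes N by rewrite -(perm_mem PR_perm) mem_cat rR orbT.
  have := @sieved_bound P [:: r]; rewrite !big_seq1 cats1 rcons_uniq all_rcons P_uniq PN /= rN.
  have -> : r \notin P.
    by apply/negP => rP; move: PR_uniq; rewrite cat_uniq => /and3P[_ /hasP[]]; exists r.
  move=> /(_ isT isT); rewrite ler_distl => /andP[_].
  by rewrite -/goodP -/V [_ / r%:R * _]mulrAC [E * w r * V]mulrAC.
pose bad := \bigcup_(r <- R) sieved P [:: r].
have bad_le : #|bad|%:R <= M * goodP * (\sum_(r <- R) r%:R^-1) + E * V * (\sum_(r <- R) w r).
  rewrite /bad; suff sub_le (R' : seq nat) : {subset R' <= R} ->
      #|\bigcup_(r <- R') sieved P [:: r]|%:R <=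
      M * goodP * (\sum_(r <- R') r%:R^-1) + E * V * (\sum_(r <- R') w r) by apply: sub_le.
  elim: R' => [|r R' IH] sub; first by rewrite !big_nil cards0 !mulr0 addr0.
  rewrite !big_cons !mulrDr.
  have h1 : (#|sieved P [:: r] :|: \bigcup_(r0 <- R') sieved P [:: r0]|%:R : rat) <=
    #|sieved P [:: r]|%:R + #|\bigcup_(r0 <- R') sieved P [:: r0]|%:R.
    by rewrite -natrD ler_nat leq_card_setU.
  have h2 := upper r (sub r (mem_head _ _)).
  have h3 : _ := IH (fun q qR => sub q (mem_behead (s := r :: R') qR)).
  lra.
have: (#|bad| < #|sieved P [::]|)%N by rewrite -(ltr_nat rat); lra.
move=> lt_card; have /subsetPn[x xS xB] : ~~ (sieved P [::] \subset bad).
  by apply/negP => /subset_leq_card; rewrite leqNgt lt_card.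
move: xS; rewrite !inE big_nil divn1 => /and4P[/eqP xN xl /eqP xc xP].
exists x; split=> //; apply: prim_root_of_primes => // p.
rewrite -(perm_mem PR_perm) mem_cat => /orP[/(allP xP)//|pR].
apply: contra xB => /eqP xp1; rewrite mem_bigcup_seq.
apply/hasP; exists p => //.
by rewrite !inE big_seq1 xp1 xl xc xP !eqxx.
Qed.

End PrimeSieve.

(** * The action of polynomials through Frobenius *)

Lemma F2_cases (c : 'F_2) : c = 0 \/ c = 1.
Proof. by case: c => -[|[|//]] i; [left|right]; apply: val_inj. Qed.

Section FrobeniusAction.

Variable L : splittingFieldType 'F_2.
Local Notation K := (finvect_type L).
Local Notation m := (\dim {: L}).
Implicit Types (g h : {poly 'F_2}) (x y : K).

Lemma card_finvect : #|K| = (2 ^ m)%N.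
Proof.
have := @card_vspace 'F_2 K _ (fullv : {vspace K}); rewrite card_Fp // => <-.
by apply/esym/eq_card => v; rewrite memvf.
Qed.

Local Notation cardK := card_finvect.
Let D2 := expD2 cardK.

Definition frob_act (g : {poly 'F_2}) (x : K) : K :=
  \sum_(i < size g) g`_i *: x ^+ (2 ^ i).

Lemma frob_act_widen n g x : (size g <= n)%N ->
  frob_act g x = \sum_(i < n) g`_i *: x ^+ (2 ^ i).
Proof.
move=> le_n; rewrite /frob_act (big_ord_widen _ (fun i => g`_i *: x ^+ (2 ^ i)) le_n).
rewrite big_mkcond; apply: eq_bigr => i _; case: ltnP => // le_i.
by rewrite nth_default // scale0r.
Qed.

Lemma frob_actD g h x : frob_act (g + h) x = frob_act g x + frob_act h x.
Proof.
pose n := maxn (size g) (size h).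
rewrite !(@frob_act_widen n) ?leq_maxl ?leq_maxr ?size_polyD // -big_split.
by apply: eq_bigr => i _; rewrite coefD scalerDl.
Qed.

Lemma frob_act0l x : frob_act 0 x = 0.
Proof. by rewrite /frob_act size_poly0 big_ord0. Qed.

Lemma frob_actDr g x y : frob_act g (x + y) = frob_act g x + frob_act g y.
Proof.
by rewrite /frob_act -big_split; apply: eq_bigr => i _; rewrite D2 scalerDr.
Qed.

Lemma frob_act0r g : frob_act g 0 = 0.
Proof.
by rewrite /frob_act big1 // => i _; rewrite expr0n expn_eq0 scaler0.
Qed.

Lemma frob_actC c x : frob_act c%:P x = c *: x.
Proof.
by rewrite (@frob_act_widen 1) ?size_polyC_leq1 // big_ord1 coefC expr1.
Qed.

Lemma frob_actXM g x : frob_act (g * 'X) x = frob_act g x ^+ 2.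
Proof.
rewrite (@frob_act_widen (size g).+1); last first.
  by apply: leq_trans (size_polyMleq _ _) _; rewrite size_polyX addn2.
rewrite big_ord_recl coefMX scale0r add0r /frob_act.
rewrite (big_morph (fun y : K => y ^+ 2) (id1 := 0) (op1 := +%R)).
- apply: eq_bigr => i _; rewrite coefMX /= /bump /= add1n expnSr exprM exprZn.
  by case: (F2_cases g`_i) => ->; rewrite ?expr0n ?expr1n.
- by move=> u v; apply: (D2 u v 1%N).
- by rewrite expr0n.
Qed.

Lemma frob_actM g h x : frob_act (g * h) x = frob_act g (frob_act h x).
Proof.
elim/poly_ind: g => [|g c IH]; first by rewrite mul0r !frob_act0l.
have -> : (g * 'X + c%:P) * h = (g * h) * 'X + c%:P * h by ring.
rewrite !frob_actD !frob_actXM IH frob_actC; congr (_ + _).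
case: (F2_cases c) => ->; rewrite ?mul0r ?mul1r ?frob_act0l ?scale0r ?scale1r //.
Qed.

Lemma frob_act_Xn n x : frob_act 'X^n x = x ^+ (2 ^ n).
Proof.
elim: n => [|n IH]; first by rewrite expr0 frob_actC scale1r expr1.
by rewrite exprSr frob_actXM IH -exprM -expnSr.
Qed.

Lemma frob_act_Xm1 x : frob_act ('X^m - 1) x = 0.
Proof.
rewrite frob_actD frob_act_Xn (expf_card_pow2 cardK) -polyCN frob_actC.
by rewrite scaleN1r subrr.
Qed.

Lemma frob_act_sum n x : frob_act (\sum_(i < n) 'X^i) x = \sum_(i < n) x ^+ (2 ^ i).
Proof.
rewrite (big_morph (fun g => frob_act g x) (id1 := 0) (op1 := +%R)).
- by apply: eq_bigr => i _; rewrite frob_act_Xn.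
- by move=> g h; rewrite frob_actD.
- exact: frob_act0l.
Qed.

Definition frob_ker g : {set K} := [set x | frob_act g x == 0].

(** g acts as a polynomial of degree 2^(deg g). *)
Lemma card_frob_ker_le g : g != 0 -> (#|frob_ker g| <= 2 ^ (size g).-1)%N.
Proof.
move=> g0.
pose p : {poly K} := \sum_(i < size g) (g`_i)%:A *: 'X^(2 ^ i).
have p_hor x : p.[x] = frob_act g x.
  by rewrite horner_sum; apply: eq_bigr => i _; rewrite hornerZ hornerXn mulr_algl.
have sg : (0 < size g)%N by rewrite size_poly_gt0.
have pN0 : p != 0.
  apply/eqP => /polyP/(_ (2 ^ (size g).-1)%N)/eqP; rewrite coef0 coef_sum.
  have lt_s : ((size g).-1 < size g)%N by rewrite prednK.
  rewrite (bigD1 (Ordinal lt_s)) //= big1 ?addr0.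
    rewrite coefZ coefXn eqxx mulr1 scaler_eq0 oner_eq0 orbF -/(lead_coef g).
    by rewrite lead_coef_eq0 (negPf g0).
  move=> i; rewrite coefZ coefXn eqn_exp2l // -val_eqE /= eq_sym => /negPf->.
  by rewrite mulr0.
have := max_poly_roots (rs := enum (frob_ker g)) pN0.
have -> : all (root p) (enum (frob_ker g)).
  by apply/allP => x; rewrite mem_enum inE rootE p_hor.
rewrite enum_uniq -cardE => /(_ isT isT) lt_p.
rewrite -ltnS; apply: leq_trans lt_p _.
apply: leq_trans (size_sum _ _ _) _; apply/bigmax_leqP => i _.
apply: leq_trans (size_scale_leq _ _) _.
by rewrite size_polyXn ltnS leq_exp2l // -ltnS prednK.
Qed.

(** If X^m - 1 = u g, the image of g lies in the kernel of u; comparing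
    cardinals, both bounds of card_frob_ker_le are attained. *)
Lemma card_frob_ker g : g %| 'X^m - 1 -> #|frob_ker g| = (2 ^ (size g).-1)%N.
Proof.
move=> /dvdpP[u uE].
have m_gt0 : (0 < m)%N := card_pow2_exp_gt0 cardK.
have s0 : size ('X^m - 1 : {poly 'F_2}) = m.+1 by rewrite size_XnsubC.
have nz : u * g != 0 by rewrite -uE -size_poly_eq0 s0.
have [u0 g0] : u != 0 /\ g != 0 by apply/andP; rewrite -negb_or -mulf_eq0.
apply/eqP; rewrite eqn_leq card_frob_ker_le //=.
pose im := frob_act g @: [set: K].
have im_le : (#|im| <= 2 ^ (size u).-1)%N.
  apply: leq_trans (card_frob_ker_le u0); apply: subset_leq_card.
  by apply/subsetP => _ /imsetP[x _ ->]; rewrite inE -frob_actM -uE frob_act_Xm1.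
(* A section of g embeds the field in (image of g) x (kernel of g). *)
pose sec (y : K) : K := odflt 0 [pick x | frob_act g x == y].
have secP x : frob_act g (sec (frob_act g x)) = frob_act g x.
  by rewrite /sec; case: pickP => [z /eqP //|/(_ x)]; rewrite eqxx.
pose f (x : K) := (frob_act g x, x + sec (frob_act g x)).
have f_inj : injective f by move=> x y [E]; rewrite E => /addIr.
have im_sub : f @: [set: K] \subset setX im (frob_ker g).
  apply/subsetP => _ /imsetP[x _ ->]; rewrite !inE /= imset_f ?inE //=.
  by rewrite frob_actDr secP (addxx2 cardK).
have := subset_leq_card im_sub.
rewrite card_imset // cardsT cardK cardsX => le_m.
have sM : ((size u).-1 + (size g).-1 = m)%N.
  have := size_mul u0 g0; rewrite -uE s0.
  move: u0 g0; rewrite -!size_poly_gt0.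
  by case: (size u) => // a _; case: (size g) => // b _; rewrite addSn addnS /= => -[].
rewrite -(leq_pmul2l (m := 2 ^ (size u).-1)) ?expn_gt0 // -expnD sM.
apply: leq_trans le_m _; by rewrite leq_mul2r im_le orbT.
Qed.

Lemma frob_act_dvd g h x : g %| h -> frob_act g x = 0 -> frob_act h x = 0.
Proof. by move=> /dvdpP[u ->] g0; rewrite frob_actM g0 frob_act0r. Qed.

Lemma frob_act_gcd g h x : frob_act g x = 0 -> frob_act h x = 0 ->
  frob_act (gcdp g h) x = 0.
Proof.
move=> g0 h0; have [[u v] /= /eqpP[[c1 c2] /= /andP[c10 c20] E]] := Bezoutp g h.
have scE (c : 'F_2) (r : {poly 'F_2}) : c != 0 -> c *: r = r.
  by case: (F2_cases c) => ->; rewrite ?eqxx // scale1r.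
move: E; rewrite !scE // => <-.
by rewrite frob_actD !frob_actM g0 h0 !frob_act0r addr0.
Qed.

(** The Frobenius map preserves the trace, so its adjoint is its inverse,
    raising to the power 2^(m-1). *)
Lemma tr_adjoint g (be : K) :
  exists al : K, forall x, tr m (be * frob_act g x) = tr m (al * x).
Proof.
elim/poly_ind: g be => [|g c IH] be.
  by exists 0 => x; rewrite frob_act0l mulr0 mul0r.
have m_gt0 : (0 < m)%N := card_pow2_exp_gt0 cardK.
have [al alP] := IH (be ^+ (2 ^ m.-1)).
exists (al + c *: be) => x.
rewrite frob_actD frob_actXM frob_actC mulrDr mulrDl !(trD cardK); congr (_ + _).
  rewrite -alP -[RHS](tr_frob cardK) exprMn -exprM -expnSr prednK //.
  by rewrite (expf_card_pow2 cardK).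
by rewrite -scalerAl -scalerAr.
Qed.

End FrobeniusAction.

(** * Normality as linear conditions *)

Lemma F2_monic (p : {poly 'F_2}) : p != 0 -> p \is monic.
Proof.
by rewrite -lead_coef_eq0 monicE; case: (F2_cases (lead_coef p)) => ->; rewrite ?eqxx.
Qed.

Lemma F2_irreducible_eq (f g : {poly 'F_2}) :
  irreducible_poly f -> irreducible_poly g -> f %| g -> f = g.
Proof.
move=> f_irr g_irr fg; have [f1 _] := f_irr; have [g1 g_dv] := g_irr.
have := g_dv f; rewrite neq_ltn f1 orbT => /(_ isT fg).
by rewrite eqp_monic ?F2_monic ?irredp_neq0 // => /eqP.
Qed.

Lemma F2_irreducible_coprime (f g : {poly 'F_2}) :
  irreducible_poly f -> irreducible_poly g -> f != g -> coprimep f g.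
Proof.
move=> f_irr g_irr; rewrite irreducible_poly_coprime //; apply: contraNN => fg.
by apply/eqP; apply: F2_irreducible_eq.
Qed.

Lemma irreducible_factor (F : finFieldType) (g : {poly F}) : (1 < size g)%N ->
  exists2 f, irreducible_poly f & f %| g.
Proof.
have [n] := ubnP (size g); elim: n => // n IH in g *; rewrite ltnS => le_n g1.
have [/irreducibleP g_irr|] := boolP (irreducibleb g); first by exists g.
rewrite /irreducibleb g1 /= => /forallPn[q].
rewrite negb_imply -Pdiv.Idomain.dvdpE -ltnNge => /andP[qg q1].
have le_q : (size q < n)%N.
  apply: leq_trans le_n; rewrite -[in X in (_ <= X)%N](prednK (ltnW g1)) ltnS.
  exact: size_npoly.
have [f f_irr fq] := IH q le_q q1.
by exists f => //; apply: dvdp_trans qg.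
Qed.

Section NormalFunctionals.

Variable L : splittingFieldType 'F_2.
Local Notation K := (finvect_type L).
Local Notation m := (\dim {: L}).
Local Notation cardK := (card_finvect L).

Definition all_ones n : {poly 'F_2} := \sum_(i < n) 'X^i.
Local Notation h := (all_ones m).

Lemma Xm1_all_ones n : 'X^n - 1 = ('X - 1) * all_ones n.
Proof. exact: subrX1. Qed.

Lemma size_all_ones n : size (all_ones n) = n.
Proof.
rewrite (_ : all_ones n = \poly_(i < n) 1); last first.
  by rewrite poly_def; apply: eq_bigr => i _; rewrite scale1r.
case: n => [|n]; first by rewrite poly_def big_ord0 size_poly0.
by rewrite size_poly_eq ?oner_eq0.
Qed.

Lemma all_ones_dvd : h %| 'X^m - 1.
Proof. by rewrite Xm1_all_ones dvdp_mull. Qed.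

Lemma frob_act_all_ones (x : K) : frob_act h x = tr m x.
Proof. exact: frob_act_sum. Qed.

(** Let f^e be the exact power of f in h.  The kernel of f^e is larger than
    that of f^(e-1), so it contains a z with (h / f) z nonzero; every h / g with
    g <> f is a multiple of f^e and kills z.  Then al is the adjoint image of an
    element pairing to 1 with (h / f) z. *)
Lemma irreducible_dual (f : {poly 'F_2}) : irreducible_poly f -> f %| h ->
  exists al z : K,
  [/\ forall x : K, frob_act (h %/ f) x = 0 -> tr m (al * x) = 0,
      tr m (al * z) = 1, frob_act h z = 0 &
      forall g, irreducible_poly g -> g %| h -> g != f -> frob_act (h %/ g) z = 0].
Proof.
move=> f_irr fh; have [f1 _] := f_irr; have f0 := irredp_neq0 f_irr.
have m_gt0 : (0 < m)%N := card_pow2_exp_gt0 cardK.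
have h0 : h != 0 by rewrite -size_poly_gt0 size_all_ones.
have sfX n : (n < size (f ^+ n))%N.
  have: (0 < size (f ^+ n)%R)%N by rewrite size_poly_gt0 expf_neq0.
  move: (size_exp f n); case: (size (f ^+ n)) => //= s -> _; rewrite ltnS.
  by move: f1; case: (size f) => [|[|t]] //= _; rewrite mulSn leq_addr.
have ex_e : exists e, f ^+ e %| h by exists 0%N; rewrite expr0 dvd1p.
have e_le e : f ^+ e %| h -> (e <= m)%N.
  move/(dvdp_leq h0); rewrite size_all_ones => le_m.
  by apply: ltnW; apply: leq_trans (sfX e) le_m.
case: (ex_maxnP ex_e e_le) => e fe_h e_max.
have e_gt0 : (0 < e)%N by apply: e_max; rewrite expr1.
pose u := h %/ f ^+ e.
have hE : h = u * f ^+ e by rewrite divpK.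
have co_u : coprimep f u.
  rewrite irreducible_poly_coprime //; apply/negP => fu.
  have := e_max e.+1; rewrite ltnn => H; suff: false by []; apply: H.
  by rewrite hE exprS dvdp_mul.
have h_f : h %/ f = u * f ^+ e.-1.
  by rewrite hE -{1}(prednK e_gt0) exprSr mulrA mulpK.
have feX : f ^+ e %| 'X^m - 1 by apply: dvdp_trans all_ones_dvd.
have feX' : f ^+ e.-1 %| 'X^m - 1.
  by apply: dvdp_trans feX; rewrite dvdp_exp2l // leq_pred.
have /subsetPn[z] : ~~ (frob_ker L (f ^+ e) \subset frob_ker L (f ^+ e.-1)).
  apply/negP => /subset_leq_card; rewrite !card_frob_ker // leq_exp2l //.
  rewrite !size_exp /= leqNgt => /negP[].
  rewrite -[in X in (_ < X)%N](prednK e_gt0) mulnS -[X in (X < _)%N]add0n ltn_add2r.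
  by move: f1; case: (size f) => [|[|s]].
rewrite !inE => /eqP zK zN.
(* h / f and f^e have gcd f^(e-1), which does not kill z. *)
have hz : frob_act (h %/ f) z != 0.
  apply: contra zN => /eqP hz0; apply/eqP.
  have : frob_act (gcdp (f ^+ e) (h %/ f)) z = 0 by apply: frob_act_gcd.
  apply: frob_act_dvd.
  rewrite h_f -{1}(prednK e_gt0) exprS.
  apply: dvdp_trans (_ : gcdp (f * f ^+ e.-1) (u * f ^+ e.-1) %| _).
    by [].
  rewrite -(eqp_dvdl _ (mulp_gcdl _ _ _)) -[X in _ %| X]mul1r dvdp_mul //.
  by move: co_u; rewrite -gcdp_eqp1 => /eqp_dvdl ->; rewrite dvd1p.
have [y y1] := tr_surj cardK.
have [al alP] := tr_adjoint (h %/ f) (y / frob_act (h %/ f) z).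
exists al, z; split=> [x x0||| g g_irr gh gf].
- by rewrite -alP x0 mulr0 tr0.
- by rewrite -alP divfK.
- by rewrite hE frob_actM zK frob_act0r.
- have co_g : coprimep g (f ^+ e).
    by rewrite coprimep_expr // F2_irreducible_coprime.
  have gu : g %| u by move: gh; rewrite {1}hE Gauss_dvdpl.
  by rewrite hE -divp_mulAC // frob_actM zK frob_act0r.
Qed.

End NormalFunctionals.

Section NormalCriterion.

Variable L : splittingFieldType 'F_2.
Local Notation K := (finvect_type L).
Local Notation m := (\dim {: L}).
Local Notation cardK := (card_finvect L).
Local Notation h := (all_ones m).

(** The dual element of a new factor f is killed by all functionals chosen
    before, so the new functional is independent of them.  The last clause is
    what the induction needs for that. *)
Lemma irreducible_functionals (Fs : seq {poly 'F_2}) : uniq Fs ->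
    (forall f, f \in Fs -> irreducible_poly f /\ f %| h) ->
  exists l : seq (K * bool),
  [/\ size l = (size Fs).+1, sums_free (map fst l),
      forall x : K, tr_conds m l x ->
        tr m x = 0 /\ forall f, f \in Fs -> frob_act (h %/ f) x != 0 &
      forall z : K, frob_act h z = 0 ->
        (forall f, f \in Fs -> frob_act (h %/ f) z = 0) ->
        forall b, b \in map fst l -> tr m (b * z) = 0].
Proof.
elim: Fs => [_ _|f Fs IH /= /andP[fFs Fs_uniq] Fs_irr].
  exists [:: (1, false)]; split => //=.
  - by rewrite inE oner_eq0.
  - by move=> x; rewrite andbT mul1r => /eqP.
  - by move=> z hz _ b; rewrite inE => /eqP->; rewrite mul1r -frob_act_all_ones.
have [|l [l_size l_free l_cond l_kill]] := IH Fs_uniq.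
  by move=> g gFs; apply: Fs_irr; rewrite inE gFs orbT.
have [f_irr fh] := Fs_irr f (mem_head _ _).
have [al [z [al_kill alz hz z_kill]]] := irreducible_dual f_irr fh.
have z_l : forall b, b \in map fst l -> tr m (b * z) = 0.
  apply: l_kill => // g gFs.
  have [g_irr gh] : irreducible_poly g /\ g %| h by apply: Fs_irr; rewrite inE gFs orbT.
  by apply: z_kill => //; apply: contraNneq fFs => <-.
exists ((al, true) :: l); split=> /=.
- by rewrite l_size.
- rewrite l_free andbT; apply/negP => /(subset_sums_tr0 cardK z_l).
  by move/eqP; rewrite alz oner_eq0.
- move=> x /andP[/eqP alx /l_cond[x0 xFs]]; split=> // g; rewrite inE => /orP[/eqP->|/xFs//].
  apply/eqP => /al_kill; rewrite alx => /eqP; by rewrite oner_eq0.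
- move=> y hy y_kill b; rewrite inE => /orP[/eqP->|bl].
    by apply: al_kill; apply: y_kill; rewrite mem_head.
  by apply: (l_kill y hy) => // g gFs; apply: y_kill; rewrite inE gFs orbT.
Qed.

Lemma size_conjugates (x : L) : size (Defs.conjugates x) = m.
Proof. by rewrite size_map size_iota. Qed.

Lemma nth_conjugates (x : L) i : (i < m)%N -> (Defs.conjugates x)`_i = x ^+ (2 ^ i).
Proof.
by move=> lt_i; rewrite (nth_map 0%N) ?size_iota // nth_iota // add0n card_Fp.
Qed.

(** The first m - 1 conjugates are independent, and the last one is the sum
    of the others because the trace vanishes. *)
Lemma one_normal_of_free (x : K) : tr m x = 0 ->
  (forall g : {poly 'F_2}, (size g < m)%N -> frob_act g x = 0 -> g = 0) ->
  k_normal 1 (x : L).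
Proof.
move=> x0 x_free; have m_gt0 : (0 < m)%N := card_pow2_exp_gt0 cardK.
rewrite /k_normal addn1.
have cE : Defs.conjugates (x : L) =
    rcons (take m.-1 (Defs.conjugates (x : L))) ((x : L) ^+ (2 ^ m.-1)).
  rewrite -[LHS](take_size) size_conjugates -{1}(prednK m_gt0).
  rewrite (take_nth 0) ?size_conjugates ?prednK //.
  by rewrite nth_conjugates // prednK.
set X := take _ _ in cE.
have sX : size X = m.-1 by rewrite size_take size_conjugates prednK // leqnn.
have nX i : (i < m.-1)%N -> X`_i = x ^+ (2 ^ i).
  by move=> lt_i; rewrite nth_take // nth_conjugates // (leq_trans lt_i) ?leq_pred.
have X_free : free X.
  rewrite -[X]/(tval (@Tuple m.-1 _ X (introT eqP sX))); apply/freeP => k.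
  move=> k0.
  pose g : {poly 'F_2} := \poly_(i < m.-1) (if insub i is Some j then k j else 0).
  have sg : (size g <= m.-1)%N by apply: size_poly.
  have g0 : g = 0.
    apply: x_free; first by rewrite -[X in (_ < X)%N]prednK.
    rewrite (@frob_act_widen _ m.-1) // -[RHS]k0; apply: eq_bigr => i _.
    by rewrite coef_poly ltn_ord valK /= nX.
  move=> i; have := congr1 (fun p : {poly 'F_2} => p`_i) g0.
  by rewrite /= coef_poly ltn_ord valK coef0.
have <- : (<<X>>)%VS = <<Defs.conjugates (x : L)>>%VS.
  rewrite cE -cats1 span_cat span_seq1; apply/esym/addv_idPl.
  rewrite -memvE.
  have -> : (x : L) ^+ (2 ^ m.-1) = \sum_(i < m.-1) X`_i.
    have : \sum_(i < m.-1.+1) x ^+ (2 ^ i) = 0 by rewrite (prednK m_gt0).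
    rewrite big_ord_recr /= => /eqP.
    rewrite addr_eq0 (oppx2 cardK) => /eqP <-.
    by apply: eq_bigr => i _; rewrite nX.
  by apply: rpred_sum => i _; apply/memv_span/mem_nth; rewrite sX.
by move/eqP: X_free => ->; rewrite sX prednK.
Qed.

(** The polynomials killing x form an ideal.  It contains h, and if it
    contained a nonzero g of degree at most m - 2 it would contain the gcd of g
    and h, hence h / f for some irreducible f. *)
Lemma one_normal_of_irreducible (x : K) : tr m x = 0 ->
  (forall f, irreducible_poly f -> f %| h -> frob_act (h %/ f) x != 0) ->
  k_normal 1 (x : L).
Proof.
move=> x0 x_irr; apply: one_normal_of_free => // g lt_g g0.
apply/eqP; apply: contraT => gN0.
have m_gt0 : (0 < m)%N := card_pow2_exp_gt0 cardK.
have h0 : h != 0 by rewrite -size_poly_gt0 size_all_ones.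
have d0 : frob_act (gcdp g h) x = 0.
  by apply: frob_act_gcd => //; rewrite frob_act_all_ones.
have d_h : gcdp g h %| h := dvdp_gcdr _ _.
have lt_d : (size (gcdp g h) < m)%N by apply: leq_ltn_trans (leq_gcdpl _ gN0) lt_g.
pose q := h %/ gcdp g h.
have s1 : (1 < size q)%N.
  rewrite /q size_divp ?gcdp_eq0 ?negb_and ?gN0 // size_all_ones.
  by rewrite ltn_subRL addn1 prednK // size_poly_gt0 gcdp_eq0 negb_and gN0.
have [f f_irr f_dv] := irreducible_factor s1.
have fh : f %| h by apply: dvdp_trans f_dv (divp_dvd d_h).
have := x_irr f f_irr fh; suff -> : frob_act (h %/ f) x = 0 by rewrite eqxx.
apply: frob_act_dvd d0.
have -> : h %/ f = q %/ f * gcdp g h by rewrite divp_mulAC // divpK.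
exact: dvdp_mull.
Qed.

End NormalCriterion.

(** * The number of irreducible factors *)

Lemma irreducible_divisors (F : finFieldType) (g : {poly F}) : g != 0 ->
  exists Fs : seq {poly F}, uniq Fs /\
    forall f, f \in Fs <-> irreducible_poly f /\ f %| g.
Proof.
move=> g0; pose n := size g.
exists [seq f <- [seq val p | p : {poly_n F}] | irreducibleb f && (f %| g)].
split; first by rewrite filter_uniq // map_inj_uniq ?enum_uniq //; apply: val_inj.
move=> f; rewrite mem_filter; split=> [/andP[/andP[/irreducibleP f_irr fg] _]|[f_irr fg]] //.
rewrite fg andbT; apply/andP; split; first exact/irreducibleP.
have sf : (size f <= n)%N by apply: dvdp_leq.
by apply/mapP; exists (NPoly sf); rewrite ?mem_enum.
Qed.

Lemma prod_irreducible_dvd (Fs : seq {poly 'F_2}) (g : {poly 'F_2}) : uniq Fs ->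
  (forall f, f \in Fs -> irreducible_poly f /\ f %| g) -> \prod_(f <- Fs) f %| g.
Proof.
elim: Fs => [|f Fs IH] /=; first by rewrite big_nil dvd1p.
case/andP=> fFs Fs_uniq Fs_irr; rewrite big_cons.
have [f_irr fg] := Fs_irr f (mem_head _ _).
have sub q : q \in Fs -> irreducible_poly q /\ q %| g.
  by move=> qFs; apply: Fs_irr; rewrite inE qFs orbT.
rewrite Gauss_dvdp ?fg ?IH //.
rewrite big_seq; elim/big_ind: _ => [|p q|q qFs]; rewrite ?coprimep1 //.
  by move=> co1 co2; rewrite coprimepMr co1.
apply: F2_irreducible_coprime; rewrite ?(sub q qFs).1 //.
  by case: (sub q qFs).
by apply: contraNneq fFs => ->.
Qed.

Lemma sum_deg_irreducible_le (Fs : seq {poly 'F_2}) n : (0 < n)%N -> uniq Fs ->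
  (forall f, f \in Fs -> irreducible_poly f /\ f %| 'X^n - 1) ->
  (\sum_(f <- Fs) (size f).-1 <= n)%N.
Proof.
move=> n_gt0 Fs_uniq Fs_irr.
have := prod_irreducible_dvd Fs_uniq Fs_irr.
have X0 : ('X^n - 1 : {poly 'F_2}) != 0 by rewrite -size_poly_gt0 size_XnsubC.
move/(dvdp_leq X0); rewrite size_XnsubC //.
suff -> : size (\prod_(f <- Fs) f) = (\sum_(f <- Fs) (size f).-1).+1 by rewrite ltnS.
elim: Fs Fs_irr {Fs_uniq} => [|f Fs IH] Fs_irr; first by rewrite !big_nil size_poly1.
have f0 : f != 0 by apply: irredp_neq0; case: (Fs_irr f (mem_head _ _)).
have sub q : q \in Fs -> irreducible_poly q /\ q %| 'X^n - 1.
  by move=> qFs; apply: Fs_irr; rewrite inE qFs orbT.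
have {}IH := IH sub.
have P0 : \prod_(f <- Fs) f != 0 by rewrite -size_poly_gt0 IH.
rewrite !big_cons size_mul // IH addnS /=.
by rewrite -[in LHS](prednK (n := size f)) ?size_poly_gt0.
Qed.

Lemma irreducible_dvd_root (f g : {poly 'F_2}) (L : fieldExtType 'F_2) (z : L) :
  irreducible_poly f -> root (map_poly (in_alg L) f) z ->
  root (map_poly (in_alg L) g) z -> f %| g.
Proof.
move=> f_irr fz gz; case: (boolP (f %| g)) => //; rewrite -irreducible_poly_coprime //.
by rewrite -(coprimep_map (in_alg L)) => /coprimep_root/(_ fz); rewrite -rootE gz.
Qed.

(** A root of f generates a field with 2^(deg f) elements, so its order
    divides 2^(deg f) - 1 as well as n. *)
Lemma irreducible_dvd_Xgcd (f : {poly 'F_2}) n : irreducible_poly f -> (0 < n)%N ->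
  f %| 'X^n - 1 -> f %| 'X^(gcdn n (2 ^ (size f).-1 - 1)) - 1.
Proof.
move=> f_irr n_gt0 f_n; set d := (size f).-1.
have [L dimL [z fz defL]] := irredp_FAdjoin f_irr.
have rootXn k : z ^+ k = 1 -> root (map_poly (in_alg L) ('X^k - 1)) z.
  by move=> zk; rewrite rmorphB rmorph1 /= map_polyXn rootE !hornerE zk subrr.
have zn : z ^+ n = 1.
  have [u uE] := dvdpP _ _ f_n.
  have : root (map_poly (in_alg L) ('X^n - 1)) z by rewrite uE rmorphM rootM fz orbT.
  by rewrite rmorphB rmorph1 /= map_polyXn rootE !hornerE subr_eq0 => /eqP.
have z0 : z != 0.
  by apply: contra_eq_neq zn => ->; rewrite expr0n eqn0Ngt n_gt0 eq_sym oner_eq0.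
have cardL : #|finvect_type L| = (2 ^ d)%N.
  have := @card_vspace 'F_2 (finvect_type L) _ (fullv : {vspace finvect_type L}).
  rewrite card_Fp // => E; rewrite /d -dimL -E.
  by apply/esym/eq_card => v; rewrite memvf.
have zd : z ^+ (2 ^ d - 1) = 1.
  have d1 : ((2 ^ d - 1).+1 = 2 ^ d)%N by rewrite subn1 prednK ?expn_gt0.
  apply: (mulfI z0); rewrite mulr1 -exprS d1.
  by have := expf_card (z : finvect_type L); rewrite cardL.
apply: (irreducible_dvd_root f_irr fz); apply: rootXn.
case: (egcdnP (2 ^ d - 1) n_gt0) => u v E _.
have : z ^+ (u * n) = 1 by rewrite mulnC exprM zn expr1n.
by rewrite E exprD mulnC exprM zd expr1n mul1r.
Qed.

Definition deg_count d (Fs : seq {poly 'F_2}) := count (fun f : {poly 'F_2} => size f == d.+1) Fs.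

(** All these factors, and X - 1, divide X^g - 1 with g = gcd(n, 2^d - 1). *)
Lemma deg_count_le (Fs : seq {poly 'F_2}) n d : (0 < n)%N -> (1 < d)%N -> uniq Fs ->
  (forall f, f \in Fs -> irreducible_poly f /\ f %| 'X^n - 1) ->
  (d * deg_count d Fs < gcdn n (2 ^ d - 1))%N.
Proof.
move=> n_gt0 d_gt1 Fs_uniq Fs_irr.
set k := gcdn _ _; have k_gt0 : (0 < k)%N by rewrite gcdn_gt0 n_gt0.
pose Gs := [seq f : {poly 'F_2} <- Fs | size f == d.+1].
have Gs_irr f : f \in ('X - 1) :: Gs -> irreducible_poly f /\ f %| 'X^k - 1.
  rewrite inE => /orP[/eqP->|].
    split; first exact: irredp_XsubC.
    by rewrite subrX1 dvdp_mulr.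
  rewrite mem_filter => /andP[/eqP sf /Fs_irr[f_irr f_n]]; split=> //.
  by have := irreducible_dvd_Xgcd f_irr n_gt0 f_n; rewrite sf.
have Gs_uniq : uniq (('X - 1) :: Gs).
  rewrite /= filter_uniq // andbT mem_filter size_XsubC.
  by rewrite eqSS eq_sym (gtn_eqF d_gt1).
have := sum_deg_irreducible_le k_gt0 Gs_uniq Gs_irr.
rewrite big_cons size_XsubC /= add1n.
rewrite big_filter (eq_bigr (fun=> d)); last by move=> f /eqP->.
by rewrite big_const_seq iter_addn addn0.
Qed.

Lemma deg_count1_le (Fs : seq {poly 'F_2}) n : (0 < n)%N -> uniq Fs ->
  (forall f, f \in Fs -> irreducible_poly f /\ f %| 'X^n - 1) ->
  (deg_count 1 Fs <= 1)%N.
Proof.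
move=> n_gt0 Fs_uniq Fs_irr.
pose Gs := [seq f : {poly 'F_2} <- Fs | size f == 2%N].
have Gs_irr f : f \in Gs -> irreducible_poly f /\ f %| 'X^1 - 1.
  rewrite mem_filter => /andP[/eqP sf /Fs_irr[f_irr f_n]]; split=> //.
  by have := irreducible_dvd_Xgcd f_irr n_gt0 f_n; rewrite sf gcdn1.
have := sum_deg_irreducible_le (isT : (0 < 1)%N) (filter_uniq _ Fs_uniq) Gs_irr.
rewrite big_filter (eq_bigr (fun=> 1%N)); last by move=> f /eqP->.
by rewrite sum1_count.
Qed.

(** Each factor of degree d <= 5 is charged d + (6 - d), the others their
    degree, so each at least 6; the degrees sum to at most n. *)
Lemma card_irreducible_divisors_le (Fs : seq {poly 'F_2}) n : (0 < n)%N -> uniq Fs ->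
  (forall f, f \in Fs -> irreducible_poly f /\ f %| 'X^n - 1) ->
  (6 * size Fs <= n + 5 + 4 * deg_count 2 Fs + 3 * deg_count 3 Fs
                   + 2 * deg_count 4 Fs + deg_count 5 Fs)%N.
Proof.
move=> n_gt0 Fs_uniq Fs_irr.
have le_n := sum_deg_irreducible_le n_gt0 Fs_uniq Fs_irr.
have le1 := deg_count1_le n_gt0 Fs_uniq Fs_irr.
suff : (6 * size Fs <= \sum_(f <- Fs) (size f).-1 + 5 * deg_count 1 Fs + 4 * deg_count 2 Fs
   + 3 * deg_count 3 Fs + 2 * deg_count 4 Fs + deg_count 5 Fs)%N by lia.
elim: Fs Fs_irr {Fs_uniq le_n le1} => [|f Fs IH] Fs_irr; first by rewrite big_nil.
have [[f1 _] _] := Fs_irr f (mem_head _ _).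
have sub q : q \in Fs -> irreducible_poly q /\ q %| 'X^n - 1.
  by move=> qFs; apply: Fs_irr; rewrite inE qFs orbT.
move: (IH sub) f1; rewrite /deg_count big_cons /=.
move: (\sum_(f <- Fs) _)%N (count _ Fs) (count _ Fs) (count _ Fs) (count _ Fs) (count _ Fs).
move: (size Fs) (size f) => s d a b c e g i.
by case: d => [|[|[|[|[|[|[|d]]]]]]] //=; lia.
Qed.

(** In characteristic 2, X^(n 2^s) - 1 = (X^n - 1)^(2^s). *)
Lemma irreducible_dvd_odd_part (f : {poly 'F_2}) n s : irreducible_poly f ->
  f %| 'X^(n * 2 ^ s) - 1 -> f %| 'X^n - 1.
Proof.
move=> f_irr; rewrite exprM.
have p2 : 2%N \in [pchar {poly 'F_2}] by rewrite pchar_poly pchar_Fp.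
have -> : ('X^n ^+ (2 ^ s) - 1 : {poly 'F_2}) = ('X^n - 1) ^+ (2 ^ s).
  by rewrite !(oppr_pchar2 p2) exprDn_pchar ?expr1n // pnatX pnatE // p2.
apply: contraLR; rewrite -!irreducible_poly_coprime //.
exact: coprimep_expr.
Qed.

(** * The sieve inequality *)

(** A dyadic upper bound for p^(-1/4), to keep the estimates rational. *)
Definition sieve_weight (p : nat) : rat :=
  if (p < 16)%N then 1 else if (p < 256)%N then 2^-1 else 4^-1.

Lemma sieve_weight_gt0 p : 0 < sieve_weight p.
Proof. by rewrite /sieve_weight; case: ifP => _; [|case: ifP => _]; lra. Qed.

Lemma sieve_weight_pow4 p : (0 < p)%N -> 1 <= sieve_weight p ^+ 4 * p%:R.
Proof.
move=> p_gt0; rewrite /sieve_weight; case: ltnP => [_|p16].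
  by rewrite expr1n mul1r ler1n.
have [_|p256] := ltnP p 256.
  have : 16%:R <= p%:R :> rat by rewrite ler_nat.
  have -> : (2^-1 : rat) ^+ 4 = 16%:R^-1 by [].
  by lra.
have : 256%:R <= p%:R :> rat by rewrite ler_nat.
have -> : (4^-1 : rat) ^+ 4 = 256%:R^-1 by [].
by lra.
Qed.

Lemma pow2m1_third_facts m (N := ((2 ^ m - 1) %/ 3)%N) : (4 < m)%N -> (3 %| 2 ^ m - 1)%N ->
  [/\ (0 < N)%N, (N %| 2 ^ m - 1)%N, (N < 2 ^ m)%N,
      3 * N%:R = (2 ^ m)%:R - 1 :> rat & 15 * (2 ^ m)%:R < 48 * N%:R :> rat].
Proof.
move=> m_gt4 m3.
have pow_gt1 : (16 < 2 ^ m)%N by rewrite -[16%N]/(2 ^ 4)%N ltn_exp2l.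
have NE : (N * 3 = 2 ^ m - 1)%N by rewrite divnK.
have N3 : 3 * N%:R = (2 ^ m)%:R - 1 :> rat.
  by rewrite -natrM mulnC NE natrB // expn_gt0.
split; last 1 first.
- have q16 : 16%:R < (2 ^ m)%:R :> rat by rewrite ltr_nat.
  lra.
- by move: NE pow_gt1 {N3}; move: (2 ^ m)%N @N => q N' E q16; lia.
- by rewrite -NE dvdn_mulr.
- by move: NE pow_gt1 {N3}; move: (2 ^ m)%N @N => q N' E q16; lia.
- exact: N3.
Qed.

Lemma sub1_mul_sqr_le (q : rat) : (q - 1) * q ^+ 2 <= q * q ^+ 2.
Proof. by have := sqr_ge0 q; lra. Qed.

Lemma three_quarters_le m : (3 * m <= (m - m %/ 4) * 4)%N.
Proof. lia. Qed.

(** The condition under which the main term of the sieve exceeds the error,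
    with N of size 2^m / 3 and error 2^(m - m/4); 48 / 15 replaces 3 to absorb the
    difference between 2^m and 2^m - 1.  Here n and s come from any writing
    m = n 2^s, and k bounds the number of irreducible factors of X^n - 1. *)
Definition sieve_inequality m :=
  exists n s k (P R : seq nat),
  [/\ (m = n * 2 ^ s)%N,
      forall Fs : seq {poly 'F_2}, uniq Fs ->
        (forall f, f \in Fs -> irreducible_poly f /\ f %| 'X^n - 1) -> (size Fs <= k)%N,
      perm_eq (P ++ R) (primes ((2 ^ m - 1) %/ 3)),
      \sum_(r <- R) r%:R^-1 < 1 :> rat &
      48 * 2 ^+ k.+2 * \prod_(p <- P) (1 + sieve_weight p) *
        (1 + \sum_(r <- R) sieve_weight r) <=
      15 * 2 ^+ (m %/ 4) * \prod_(p <- P) (1 - p%:R^-1) *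
        (1 - \sum_(r <- R) r%:R^-1)].

Definition prescribed_element (L : splittingFieldType 'F_2) (c : bool) (x : finvect_type L) :=
  [/\ ((2 ^ \dim {: L} - 1) %/ 3)%N.-primitive_root x, k_normal 1 (x : L) &
      tr (\dim {: L}) x^-1 = c%:R].

Lemma sieve_rearrange (A B N Q q E V W th de a b : rat) : 0 < A -> 0 < B ->
  0 < V -> 0 < W -> 0 < de -> 0 < q -> 0 < E -> 0 < a -> a <= b -> Q = E * q ->
  B * Q < A * N -> A * b * V * W <= B * q * th * de -> E * V * W < N / a * th * de.
Proof.
move=> A0 B0 V0 W0 de0 q0 E0 a0 ab QE QN crit.
have b0 := lt_le_trans a0 ab.
have th0 : 0 < th.
  have lhs0 := mulr_gt0 (mulr_gt0 (mulr_gt0 A0 b0) V0) W0.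
  have := lt_le_trans lhs0 crit.
  by rewrite (pmulr_lgt0 _ de0) (pmulr_rgt0 _ (mulr_gt0 B0 q0)).
have Q0 : 0 < Q by rewrite QE; apply: mulr_gt0.
have N0 : 0 < N by rewrite -(pmulr_rgt0 _ A0) (lt_trans (mulr_gt0 B0 Q0)).
apply: lt_le_trans (_ : N / b * th * de <= _); last first.
  rewrite ler_wpM2r ?(ltW de0) // ler_wpM2r ?(ltW th0) // ler_wpM2l ?(ltW N0) //.
  by rewrite lef_pV2 ?posrE.
rewrite -(ltr_pM2l b0) -(ltr_pM2l A0).
have -> : A * (b * (N / b * th * de)) = A * N * (th * de).
  by field; apply: lt0r_neq0.
apply: le_lt_trans (_ : B * Q * (th * de) < _); last first.
  by rewrite ltr_pM2r // mulr_gt0.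
rewrite QE.
have -> : A * (b * (E * V * W)) = E * (A * b * V * W) by ring.
have -> : B * (E * q) * (th * de) = E * (B * q * th * de) by ring.
by rewrite ler_wpM2l // ltW.
Qed.

Section Criterion.

Variable L : splittingFieldType 'F_2.
Local Notation K := (finvect_type L).
Local Notation m := (\dim {: L}).
Local Notation cardK := (card_finvect L).

Lemma sieve_criterion (c : bool) :
  (4 < m)%N -> (3 %| 2 ^ m - 1)%N -> sieve_inequality m ->
  exists x : K, prescribed_element c x.
Proof.
move=> m_gt4 m3 [n [s [k [P [R [mE Fs_le PR_perm R_lt1 crit]]]]]].
have m_gt0 : (0 < m)%N by apply: leq_trans m_gt4.
have [N NE [N_gt0 N_dv N3]] : exists2 N, N = ((2 ^ m - 1) %/ 3)%N &
    [/\ (0 < N)%N, (N %| 2 ^ m - 1)%N & 3 * N%:R = (2 ^ m)%:R - 1 :> rat].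
  have [N_gt0 N_dv _ N3 _] := pow2m1_third_facts m_gt4 m3.
  by exists ((2 ^ m - 1) %/ 3)%N; split.
rewrite -NE in PR_perm.
have h0 : all_ones m != 0 by rewrite -size_poly_gt0 size_all_ones.
have [Fs [Fs_uniq FsP]] := irreducible_divisors h0.
have Fs_irr f : f \in Fs -> irreducible_poly f /\ f %| all_ones m by move/FsP.
have sFs : (size Fs <= k)%N.
  apply: (Fs_le _ Fs_uniq) => f /FsP[f_irr fh]; split; first exact: f_irr.
  apply: (irreducible_dvd_odd_part (s := s) f_irr); rewrite -mE.
  exact: dvdp_trans fh (all_ones_dvd L).
have [l [l_size l_free l_cond _]] := irreducible_functionals Fs_uniq Fs_irr.
(* A rational upper bound for Q^(3/4), exact when 4 divides m. *)
pose E : rat := 2 ^+ (m - m %/ 4).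
have E_ge0 : 0 <= E by rewrite exprn_ge0.
have E_ge : 3 * (2 ^ m)%:R ^+ 2 * N%:R <= E ^+ 4.
  have le3m : (3 * m <= (m - m %/ 4) * 4)%N.
    exact: three_quarters_le.
  rewrite /E -exprM; apply: le_trans (_ : 2 ^+ (3 * m) <= _); last first.
    by rewrite ler_eXn2l.
  rewrite mulrAC N3 natrX mulnC exprM [leRHS]exprS.
  exact: sub1_mul_sqr_le.
have w_ge0 p : 0 <= sieve_weight p by apply/ltW/sieve_weight_gt0.
have w_ge p : p \in primes N -> 1 <= sieve_weight p ^+ 4 * p%:R.
  by rewrite mem_primes => /and3P[/prime_gt0 p0 _ _]; apply: sieve_weight_pow4.
have [|x [x_prim x_l x_c]] := @sieve_prim_root K m cardK N l c _ E N_gt0 N_dv l_free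
   w_ge0 w_ge E_ge0 E_ge P R PR_perm; last first.
- exists x; have [x0 x_Fs] := l_cond x x_l; split; last exact: x_c.
    by rewrite -NE; apply: x_prim.
  apply: (one_normal_of_irreducible x0) => f f_irr fh.
  by apply: x_Fs; apply/FsP; split.
rewrite l_size; refine (sieve_rearrange (Q := (2 ^ m)%:R) _ _ _ _ _ _ _ _ _ _ _ crit).
- by rewrite ltr0n.
- by rewrite ltr0n.
- by apply: prodr_gt0 => p _; rewrite addr_gt0 ?sieve_weight_gt0 ?ltr01.
- by rewrite ltr_wpDr ?sumr_ge0 ?ltr01 // => r _; apply: w_ge0.
- by rewrite subr_gt0.
- exact: exprn_gt0.
- exact: exprn_gt0.
- exact: exprn_gt0.
- by rewrite ler_eXn2l.
- by rewrite /E -exprD subnK ?leq_div // natrX.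
- by rewrite NE; have [_ _ _ _] := pow2m1_third_facts m_gt4 m3.
Qed.

End Criterion.

(** The product of the distinct primes of N is at most N. *)
Lemma count_large_primes N b e : (0 < N)%N -> (N < 2 ^ e)%N ->
  (b * count (fun r => 2 ^ b <= r)%N (primes N) <= e)%N.
Proof.
move=> N_gt0 N_lt; set R := [seq r <- primes N | (2 ^ b <= r)%N].
have R_uniq : uniq R by rewrite filter_uniq // primes_uniq.
have RN : all (mem (primes N)) R.
  by apply/allP => r; rewrite mem_filter => /andP[].
have [R_dv _] := prod_primes_dvd R_uniq RN.
rewrite -size_filter -/R -(@leq_exp2l 2) // ltnW //.
apply: leq_ltn_trans N_lt; apply: leq_trans (dvdn_leq N_gt0 R_dv).
rewrite expnM; have : all (fun r => 2 ^ b <= r)%N R by apply: filter_all.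
elim: (R) => [|r R' IH] /=; first by rewrite big_nil.
by case/andP=> le_r /IH; rewrite big_cons expnS; apply: leq_mul.
Qed.

Lemma size_irreducible_le (n : nat) (Fs : seq {poly 'F_2}) : (0 < n)%N -> uniq Fs ->
  (forall f, f \in Fs -> irreducible_poly f /\ f %| 'X^n - 1) ->
  (size Fs <= (n + 5 + 4 * ((gcdn n 3).-1 %/ 2) + 3 * ((gcdn n 7).-1 %/ 3) +
     2 * ((gcdn n 15).-1 %/ 4) + (gcdn n 31).-1 %/ 5) %/ 6)%N.
Proof.
move=> n_gt0 Fs_uniq Fs_irr; rewrite leq_divRL // mulnC.
apply: leq_trans (card_irreducible_divisors_le n_gt0 Fs_uniq Fs_irr) _.
have le d : (1 < d)%N -> (deg_count d Fs <= (gcdn n (2 ^ d - 1)).-1 %/ d)%N.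
  move=> d_gt1; rewrite leq_divRL ?(ltnW d_gt1) // mulnC.
  have := deg_count_le n_gt0 d_gt1 Fs_uniq Fs_irr.
  by case: (gcdn _ _).
have := (le 2%N isT, le 3%N isT, le 4%N isT, le 5%N isT).
rewrite -[(2 ^ 2 - 1)%N]/3%N -[(2 ^ 3 - 1)%N]/7%N -[(2 ^ 4 - 1)%N]/15%N -[(2 ^ 5 - 1)%N]/31%N.
by case=> [[[? ?] ?] ?]; lia.
Qed.

(** * Large degrees *)

Lemma pow2_dominates T : (64 <= T)%N -> (2 ^ 14 * (600 + 288 * T) <= 15 * 2 ^ T)%N.
Proof.
move=> T64; have := ltn_expl (T - 19) (isT : (1 < 2)%N).
have -> : T = (14 + (5 + (T - 19)))%N by lia.
rewrite !expnD mulnCA leq_mul2l addnA addKn; set Y := (2 ^ (T - 19))%N => YT.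
apply/orP; right; rewrite -[(2 ^ 5)%N]/32%N.
clearbody Y; lia.
Qed.

Lemma one_sub_inv_ge0 p : (3 <= p)%N -> 0 <= 1 - p%:R^-1 :> rat.
Proof. by move=> p3; rewrite subr_ge0 invf_le1 ?ler1n ?ltr0n; case: p p3. Qed.

Lemma sieve_weight_factor p : (3 <= p)%N ->
  1 + sieve_weight p <= (1 - p%:R^-1) * (2 * (if (p < 16)%N then 2 else 1)).
Proof.
move=> p3; have p0 : 0 < p%:R :> rat by rewrite ltr0n; lia.
rewrite /sieve_weight; case: ltnP => [_|p16].
  have : p%:R^-1 <= 3%:R^-1 :> rat by rewrite lef_pV2 ?posrE // ler_nat.
  lra.
have : p%:R^-1 <= 16%:R^-1 :> rat by rewrite lef_pV2 ?posrE // ler_nat.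
by case: ifP => _; lra.
Qed.

Lemma prime_dvd_pow2m1 p e : (0 < e)%N -> prime p -> (p %| 2 ^ e - 1)%N -> odd p /\ (3 <= p)%N.
Proof.
move=> e_gt0 p_pr p_dv; have p1 := prime_gt1 p_pr.
have p_odd : odd p.
  apply: contraLR p_dv => p_even; case: (even_prime p_pr) => [->|]; last by rewrite (negPf p_even).
  by rewrite dvdn2 oddB ?expn_gt0 // oddX; case: (e) e_gt0.
by split=> //; case: p p1 p_odd {p_pr p_dv} => [|[|[|]]].
Qed.

Lemma large_rearrange (K T Q V th W D M : rat) :
  0 <= K -> 0 <= T -> 0 <= Q -> 0 <= W -> 0 <= V -> 0 <= th ->
  V <= th * T -> W <= M / 14 -> D <= 6 / 7 ->
  K * T * (336 + 24 * M) <= 15 * Q ->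
  48 * K * V * (1 + W) <= 15 * Q * th * (1 - D).
Proof.
move=> K0 T0 Q0 W0 V0 th0 V_le W_le D_le key.
have c48 : 0 <= 48 :> rat by rewrite ler0n.
have s1 : 48 * K * V * (1 + W) <= 48 * K * (th * T) * (1 + M / 14).
  apply: ler_pM.
  - exact: mulr_ge0 (mulr_ge0 c48 K0) V0.
  - exact: addr_ge0 ler01 W0.
  - exact: ler_wpM2l (mulr_ge0 c48 K0) _ _ V_le.
  - by move: W_le; clear; lra.
apply: (le_trans s1).
have c15 : 0 <= 15 :> rat by rewrite ler0n.
have s2 : th * (15 * Q / 7) <= 15 * Q * th * (1 - D).
  have -> : 15 * Q * th * (1 - D) = th * (15 * Q * (1 - D)) by ring.
  apply: (ler_wpM2l th0); apply: ler_wpM2l (mulr_ge0 c15 Q0) _ _ _.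
  by move: D_le; clear; lra.
apply: le_trans s2.
have -> : 48 * K * (th * T) * (1 + M / 14) = th * (K * T * (336 + 24 * M) / 7) by field.
apply: (ler_wpM2l th0); move: key; clear; lra.
Qed.

(** Take for P the primes p < m/6.  They are odd, hence at most m/12 in number,
    and each costs a factor 2, or 4 if p < 16.  The other primes are at least 2^7,
    so there are at most m/7 of them and their inverses sum to at most 6/7.  As X^(m/2) - 1
    has at most m/12 + 5 irreducible factors, the quotient of the left side by the product
    over P on the right is at most 2^(m/6) times a linear function of m, against
    2^(m/4). *)
Lemma large_sieve_inequality m :
  (768 <= m)%N -> ~~ odd m -> (3 %| 2 ^ m - 1)%N -> sieve_inequality m.
Proof.
move=> m_ge m_even m3.
have mE : (m = m./2 * 2 ^ 1)%N.
  by rewrite expn1 muln2 -[LHS]odd_double_half (negPf m_even).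
set n := m./2 in mE.
pose T := (m %/ 12)%N.
have T64 : (64 <= T)%N by rewrite /T; clear -m_ge; lia.
have n_gt0 : (0 < n)%N by clear -m_ge mE; lia.
have m_gt4 : (4 < m)%N by clear -m_ge; lia.
have m_gt0 : (0 < m)%N by clear -m_ge; lia.
clear m_ge.
rewrite /sieve_inequality.
have : [/\ (0 < (2 ^ m - 1) %/ 3)%N, ((2 ^ m - 1) %/ 3 %| 2 ^ m - 1)%N &
  ((2 ^ m - 1) %/ 3 < 2 ^ m)%N] by case: (pow2m1_third_facts m_gt4 m3).
move: ((2 ^ m - 1) %/ 3)%N => N [N_gt0 N_dv N_lt].
have primeN p : p \in primes N -> odd p /\ (3 <= p)%N.
  rewrite mem_primes => /and3P[p_pr _ p_dv].
  exact: prime_dvd_pow2m1 m_gt0 p_pr (dvdn_trans p_dv N_dv).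
pose k := ((n + 27) %/ 6)%N.
have Fs_le : forall Fs : seq {poly 'F_2}, uniq Fs ->
      (forall f, f \in Fs -> irreducible_poly f /\ f %| 'X^n - 1) -> (size Fs <= k)%N.
  move=> Fs Fs_uniq Fs_irr; apply: leq_trans (size_irreducible_le n_gt0 Fs_uniq Fs_irr) _.
  have g d : (0 < d)%N -> (gcdn n d <= d)%N by move=> d0; rewrite dvdn_leq // dvdn_gcdr.
  apply: leq_div2r; move: (g 3%N isT) (g 7%N isT) (g 15%N isT) (g 31%N isT).
  by move: (gcdn n 3) (gcdn n 7) (gcdn n 15) (gcdn n 31) => a b d e; clear; lia.
pose small p := (6 * p < m)%N.
pose P := [seq p <- primes N | small p].
pose R := [seq p <- primes N | ~~ small p].
have PR : perm_eq (P ++ R) (primes N) by rewrite perm_filterC.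
have P_uniq : uniq P by rewrite filter_uniq // primes_uniq.
have sP : (size P <= T)%N.
  have half_uniq : uniq [seq p./2 | p <- P].
    rewrite map_inj_in_uniq // => p q.
    rewrite !mem_filter => /andP[_ /primeN[p_odd _]] /andP[_ /primeN[q_odd _]] E.
    by rewrite -[p]odd_double_half -[q]odd_double_half p_odd q_odd E.
  have := uniq_leq_size half_uniq (s2 := iota 1 T); rewrite size_map size_iota; apply.
  move=> _ /mapP[p + ->]; rewrite mem_filter mem_iota /small => /andP[p_m /primeN[p_odd p3]].
  have := odd_double_half p; rewrite p_odd; lia.
have sP16 : (count (fun p => p < 16)%N P <= 7)%N.
  rewrite -size_filter.
  apply: (@uniq_leq_size _ _ [:: 3; 5; 7; 9; 11; 13; 15]%N); first exact: filter_uniq.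
  move=> p; rewrite mem_filter mem_filter => /and3P[p16 _ /primeN[p_odd p3]].
  by move: p p16 p_odd p3; do 16 (case=> //).
have sR : (7 * size R <= m)%N.
  apply: leq_trans (count_large_primes 7 N_gt0 N_lt); rewrite leq_mul2l /= size_filter.
  by apply: sub_count => p /=; rewrite /small -leqNgt; clear -T64; rewrite /T in T64; lia.
pose t : rat := (size R)%:R.
have tm : 7 * t <= m%:R by rewrite /t -natrM ler_nat.
have m0 : 0 < m%:R :> rat by rewrite ltr0n.
have invR : \sum_(r <- R) r%:R^-1 <= 6 / 7 :> rat.
  apply: le_trans (_ : \sum_(r <- R) 6 / m%:R <= _).
    rewrite !big_seq; apply: ler_sum => r; rewrite mem_filter /small -leqNgt => /andP[r_m rN].
    have r0 : 0 < r%:R :> rat by rewrite ltr0n; have [_ /ltnW/ltnW] := primeN r rN.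
    rewrite ler_pdivlMr // mulrC ler_pdivrMr // mulrC -natrM ler_nat.
    by rewrite mulnC.
  rewrite big_const_seq count_predT iter_addr_0 -[_ *+ size R]mulr_natr -/t.
  by rewrite mulrAC (ler_pdivrMr _ _ m0); move: tm; clear; lra.
have wR : \sum_(r <- R) sieve_weight r <= t / 2.
  apply: le_trans (_ : \sum_(r <- R) 2^-1 <= _).
    rewrite !big_seq; apply: ler_sum => r; rewrite mem_filter /small -leqNgt => /andP[r_m rN].
    rewrite /sieve_weight; case: ltnP => [|_]; [clear -r_m T64; rewrite /T in T64; lia|].
    by case: ifP => _; clear; lra.
  by rewrite big_const_seq count_predT iter_addr_0 -[_ *+ size R]mulr_natr -/t mulrC.
set V := \prod_(p <- P) (1 + sieve_weight p).
set th := \prod_(p <- P) (1 - p%:R^-1) : rat.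
have th_V : V <= th * 2 ^+ (T + 7).
  apply: le_trans (_ : th * 2 ^+ (size P + count (fun p => p < 16)%N P) <= _); last first.
    rewrite ler_wpM2l //; last by rewrite ler_eXn2l // leq_add.
    rewrite /th big_seq; apply: prodr_ge0 => p; rewrite mem_filter => /andP[_ /primeN[_ p3]].
    exact: one_sub_inv_ge0.
  rewrite /V /th; have : {subset P <= primes N} by move=> p; rewrite mem_filter => /andP[].
  elim: (P) => [|p P' IH] sub; first by rewrite !big_nil expr0 mulr1.
  rewrite !big_cons /=.
  have {}IH := IH (fun q qP => sub q (mem_behead (s := p :: P') qP)).
  have [_ p3] := primeN p (sub p (mem_head _ _)).
  have -> : (2 : rat) ^+ ((size P').+1 + ((p < 16)%N + count (fun p0 => (p0 < 16)%N) P')) =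
    2 * (if (p < 16)%N then 2 else 1) * 2 ^+ (size P' + count (fun p0 => (p0 < 16)%N) P').
    by rewrite addSn exprS addnCA exprD mulrA; case: ifP.
  rewrite mulrACA.
  apply: ler_pM (sieve_weight_factor p3) IH.
    by rewrite addr_ge0 // ltW // sieve_weight_gt0.
  by apply: prodr_ge0 => q _; rewrite addr_ge0 // ltW // sieve_weight_gt0.
exists n, 1%N, k, P, R; split; [exact: mE|exact: Fs_le|exact: PR| |].
  by apply: le_lt_trans invR _; clear; lra.
rewrite -/V -/th.
have th_ge0 : 0 <= th.
  rewrite /th big_seq; apply: prodr_ge0 => p; rewrite mem_filter => /andP[_ /primeN[_ p3]].
  exact: one_sub_inv_ge0.
have kT : (k.+2 <= T + 7)%N by rewrite /k /T; clear -mE T64; rewrite /T in T64; lia.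
have mT : (3 * T <= m %/ 4)%N by rewrite /T; clear; lia.
have mT' : (m <= 12 * T + 11)%N by rewrite /T; clear; lia.
have key : (2 ^ k.+2 * 2 ^ (T + 7) * (336 + 24 * m) <= 15 * 2 ^ (m %/ 4))%N.
  apply: leq_trans (_ : 2 ^ (T + 7) * 2 ^ (T + 7) * (600 + 288 * T) <= _)%N.
    apply: leq_mul; first by apply: leq_mul => //; rewrite leq_exp2l.
    by clear -mT'; lia.
  apply: leq_trans (_ : 15 * 2 ^ (3 * T) <= _)%N; last by rewrite leq_mul2l leq_exp2l.
  have -> : (2 ^ (T + 7) * 2 ^ (T + 7) = 2 ^ (2 * T) * 2 ^ 14)%N.
    by rewrite -!expnD; congr (2 ^ _)%N; clear; lia.
  have -> : (3 * T = 2 * T + T)%N by clear; lia.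
  rewrite expnD -mulnA [X in (_ <= X)%N]mulnCA; apply: leq_mul => //.
  exact: pow2_dominates.
move: key; rewrite -(ler_nat rat) !(natrM, natrD, natrX).
move=> key; refine (large_rearrange (T := 2 ^+ (T + 7)) (M := m%:R) _ _ _ _ _ _ _ _ _ key).
- exact: exprn_ge0.
- exact: exprn_ge0.
- exact: exprn_ge0.
- by apply: sumr_ge0 => r _; apply/ltW/sieve_weight_gt0.
- by apply: prodr_ge0 => q _; apply: addr_ge0 ler01 (ltW (sieve_weight_gt0 _)).
- exact: th_ge0.
- exact: th_V.
- by move: wR tm; clear; lra.
- exact: invR.
Qed.

(** * Middle degrees *)

Definition ratN (n : N) : rat := (N.to_nat n)%:R.

Lemma to_nat_pow2 k : N.to_nat (N.pow 2 (N.of_nat k)) = (2 ^ k)%N.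
Proof.
elim: k => [|k IH] //.
by rewrite Nat2N.inj_succ N.pow_succ_r' N2Nat.inj_mul IH expnS.
Qed.

Lemma ratND a b : ratN (N.add a b) = ratN a + ratN b.
Proof. by rewrite /ratN N2Nat.inj_add -natrD. Qed.

Lemma ratNM a b : ratN (N.mul a b) = ratN a * ratN b.
Proof. by rewrite /ratN N2Nat.inj_mul -natrM. Qed.

Lemma ratN_pow2 k : ratN (N.pow 2 (N.of_nat k)) = 2 ^+ k.
Proof. by rewrite /ratN to_nat_pow2 natrX. Qed.

Lemma ratN_of_nat k : ratN (N.of_nat k) = k%:R.
Proof. by rewrite /ratN Nat2N.id. Qed.

Lemma ratN_le a b : N.leb a b -> ratN a <= ratN b.
Proof. by move=> /N.leb_le ab; rewrite /ratN ler_nat; lia. Qed.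

Lemma ratN_lt a b : N.ltb a b -> ratN a < ratN b.
Proof. by move=> /N.ltb_lt ab; rewrite /ratN ltr_nat; lia. Qed.

Lemma ratNB a b : N.leb b a -> ratN (N.sub a b) = ratN a - ratN b.
Proof.
move=> /N.leb_le ab; have {2}-> : a = N.add (N.sub a b) b by lia.
by rewrite ratND addrK.
Qed.

Definition sumN (f : N -> N) (s : seq N) : N := foldr (fun p acc => N.add (f p) acc) 0%num s.

Lemma ratN_sum f (t : seq nat) :
  ratN (sumN f [seq N.of_nat p | p <- t]) = \sum_(p <- t) ratN (f (N.of_nat p)).
Proof.
by elim: t => [|p t IH]; rewrite ?big_nil ?big_cons //= ratND IH.
Qed.

Lemma to_nat_mod a b : b <> 0%num -> N.to_nat (N.modulo a b) = (N.to_nat a %% N.to_nat b)%N.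
Proof.
move=> b0; have E := N.Div0.div_mod a b; have lt := N.mod_lt a b b0.
move: (N.modulo a b) (N.div a b) E lt => r q -> lt.
rewrite N2Nat.inj_add N2Nat.inj_mul.
have -> : forall x y z : nat, ((x * y)%coq_nat + z)%coq_nat = (y * x + z)%N by move=> *; lia.
by rewrite modnMDl modn_small //; lia.
Qed.

(** The multiplicative order i of 2 modulo p, searched from r = 2^i mod p. *)
Fixpoint find_order (p : N) (fuel : nat) (r i : N) : option N :=
  if N.eqb r 1 then Some i
  else if fuel is f.+1 then find_order p f (N.modulo (N.double r) p) (N.succ i) else None.

Lemma find_orderP p fuel i o : (1 < p)%N ->
    find_order (N.of_nat p) fuel (N.of_nat (2 ^ i %% p)) (N.of_nat i) = Some o ->
  [/\ (i <= N.to_nat o)%N, (2 ^ N.to_nat o %% p = 1)%N &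
  forall j, (i <= j < N.to_nat o)%N -> (2 ^ j %% p)%N <> 1%N].
Proof.
move=> p1; elim: fuel i => [|f IH] i /=; case: N.eqb_spec => [r1|r1] //.
- move=> [<-]; rewrite Nat2N.id; split; [by [] | by lia | by move=> j; lia].
- move=> [<-]; rewrite Nat2N.id; split; [by [] | by lia | by move=> j; lia].
have -> : N.modulo (N.double (N.of_nat (2 ^ i %% p))) (N.of_nat p) = N.of_nat (2 ^ i.+1 %% p).
  apply: N2Nat.inj; rewrite to_nat_mod; last by lia.
  rewrite !Nat2N.id N2Nat.inj_double Nat2N.id.
  have -> : forall x : nat, (2 * x)%coq_nat = (2 * x)%N by move=> *; lia.
  by rewrite modnMmr expnS.
rewrite -Nat2N.inj_succ => /IH[io o1 oj]; split=> [||j /andP[ij jo]]; [exact: ltnW | exact: o1 |].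
have [<-|ne] := eqVneq i j; first by move=> H; apply: r1; rewrite H.
by apply: oj; rewrite jo andbT ltn_neqAle ne.
Qed.

Definition with_order (p : N) : N * option N := (p, find_order p (N.to_nat p) (N.modulo 2 p) 1).

(** A prime whose order was not found is kept: only primes known not to divide
    2^m - 1 may be discarded. *)
Definition maybe_divides (m : N) (po : N * option N) : bool :=
  if po.2 is Some o then N.eqb (N.modulo m o) 0 else true.

Lemma maybe_dividesP m p : (1 < p)%N -> (p %| 2 ^ m - 1)%N ->
  maybe_divides (N.of_nat m) (with_order (N.of_nat p)).
Proof.
move=> p1 p_dv; rewrite /maybe_divides /with_order /=.
case Eo: find_order => [o|//].
have [o_gt0 o1 oj] : [/\ (1 <= N.to_nat o)%N, (2 ^ N.to_nat o %% p = 1)%N &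
    forall j, (1 <= j < N.to_nat o)%N -> (2 ^ j %% p)%N <> 1%N].
  apply: (@find_orderP p (N.to_nat (N.of_nat p)) 1 o p1); rewrite -Eo expn1.
  by congr find_order; apply: N2Nat.inj; rewrite to_nat_mod ?Nat2N.id //; lia.
apply/N.eqb_spec/N2Nat.inj; rewrite to_nat_mod ?Nat2N.id; last by lia.
set r := (m %% N.to_nat o)%N.
have r_lt : (r < N.to_nat o)%N by rewrite ltn_pmod.
suff r1 : (2 ^ r %% p = 1)%N by case: (posnP r) => // r_gt0; case: (oj r); rewrite ?r_gt0.
have : (2 ^ m == 1 %[mod p])%N by rewrite eqn_mod_dvd ?expn_gt0.
have -> : (2 ^ m = (2 ^ N.to_nat o) ^ (m %/ N.to_nat o) * 2 ^ r)%N.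
  by rewrite -expnM -expnD (mulnC (N.to_nat o)) -divn_eq.
by rewrite -modnMml -modnXm o1 exp1n modnMml mul1n (modn_small p1) => /eqP.
Qed.

Definition weight4 (p : N) : N :=
  if N.ltb p 16 then 4%num else if N.ltb p 256 then 2%num else 1%num.

Lemma weight4E p : ratN (weight4 (N.of_nat p)) = 4 * sieve_weight p.
Proof.
rewrite /weight4 /sieve_weight.
have -> : N.ltb (N.of_nat p) 16 = (p < 16)%N.
  by apply/idP/idP => [/N.ltb_lt ?|?]; [lia | apply/N.ltb_lt; lia].
have -> : N.ltb (N.of_nat p) 256 = (p < 256)%N.
  by apply/idP/idP => [/N.ltb_lt ?|?]; [lia | apply/N.ltb_lt; lia].
have [r1 r2 r4] : [/\ ratN 1 = 1, ratN 2 = 2 & ratN 4 = 4] by [].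
by case: ifP => _; [|case: ifP => _]; rewrite ?r1 ?r2 ?r4; lra.
Qed.

Definition scaled_inv (e : nat) (p : N) : N := N.add (N.div (N.pow 2 (N.of_nat e)) p) 1.

Lemma scaled_inv_ge e p : (0 < p)%N -> p%:R^-1 <= ratN (scaled_inv e (N.of_nat p)) / 2 ^+ e.
Proof.
move=> p_gt0; have p0 : 0 < p%:R :> rat by rewrite ltr0n.
have c0 : 0 < 2 ^+ e :> rat by rewrite exprn_gt0.
rewrite -[p%:R^-1]mul1r ler_pdivlMr // mulrAC ler_pdivrMr // mul1r -(ratN_of_nat p).
rewrite -ratN_pow2 -ratNM; apply: ratN_le; apply/N.leb_le.
rewrite /scaled_inv.
have := N.Div0.div_mod (N.pow 2 (N.of_nat e)) (N.of_nat p).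
have : N.lt (N.modulo (N.pow 2 (N.of_nat e)) (N.of_nat p)) (N.of_nat p).
  by apply: N.mod_lt; lia.
move: (N.pow 2 _) => X; move: (N.modulo X _) (N.div X _) => r q; nia.
Qed.

Fixpoint odd_part (fuel m : nat) : nat :=
  if fuel is f.+1 then if odd m then m else odd_part f m./2 else m.

Lemma odd_partP fuel m : exists s, m = (odd_part fuel m * 2 ^ s)%N.
Proof.
elim: fuel m => [|f IH] m /=; first by exists 0%N; rewrite muln1.
case: ifP => m_odd; first by exists 0%N; rewrite muln1.
have [s sE] := IH m./2; exists s.+1.
by rewrite expnS mulnCA -sE mul2n -[LHS]odd_double_half m_odd.
Qed.

Definition factor_count_bound n :=
  ((n + 5 + 4 * ((gcdn n 3).-1 %/ 2) + 3 * ((gcdn n 7).-1 %/ 3) +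
     2 * ((gcdn n 15).-1 %/ 4) + (gcdn n 31).-1 %/ 5) %/ 6)%N.

(** The sieve inequality with P = {3} or empty, in integers.  The remaining
    primes of N below 2^10 are among S, and there are at most m / 10 larger ones,
    each of weight 1/4 and inverse at most 2^-10.  The weights are scaled by 4, the
    inverses by 2^(e + 10) and rounded up.  The prime 3 divides N only if 9
    divides 2^m - 1, that is if 6 divides m; the factor c = 3 is then
    (1 + 1) / (1 - 1/3). *)
Definition sieve_check (e : nat) (ps : seq (N * option N)) (m : nat) : bool :=
  let S := [seq po.1 | po <- ps & maybe_divides (N.of_nat m) po] in
  let c := N.of_nat (if (m %% 6 == 0)%N then 3 else 1)%N in
  let k := factor_count_bound (odd_part m m) in
  let big := N.of_nat (m %/ 10) in
  let W := N.add (N.add (N.of_nat 4) (sumN weight4 S)) big in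
  let scale := N.pow 2 (N.of_nat (e + 10)) in
  let D := N.add (sumN (scaled_inv (e + 10)) S) (N.mul big (N.pow 2 (N.of_nat e))) in
  N.ltb D scale &&
  N.leb (N.mul (N.mul (N.mul (N.mul (N.of_nat 48) (N.pow 2 (N.of_nat k.+2))) c) W) scale)
        (N.mul (N.mul (N.of_nat 60) (N.pow 2 (N.of_nat (m %/ 4)))) (N.sub scale D)).

Definition small_primes : seq nat := [seq p <- iota 5 1019 | prime p].

Lemma pow2_mod9 m : (9 %| 2 ^ m - 1)%N -> (m %% 6 == 0)%N.
Proof.
have -> : (9 %| 2 ^ m - 1)%N = (2 ^ m == 1 %[mod 9])%N by rewrite eqn_mod_dvd ?expn_gt0.
have -> : (2 ^ m = (2 ^ 6) ^ (m %/ 6) * 2 ^ (m %% 6))%N.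
  by rewrite -expnM -expnD (mulnC 6%N) -divn_eq.
rewrite -modnMml -modnXm -[((2 ^ 6) %% 9)%N]/1%N exp1n -[(1 %% 9)%N]/1%N mul1n.
by case: (m %% 6)%N (ltn_pmod m (isT : 0 < 6)%N) => [|[|[|[|[|[|r]]]]]].
Qed.

Lemma ler_sum_sub (s t : seq nat) (F : nat -> rat) : uniq s -> uniq t -> {subset s <= t} ->
  (forall p, 0 <= F p) -> \sum_(p <- s) F p <= \sum_(p <- t) F p.
Proof.
move=> s_uniq t_uniq st F0.
have -> : \sum_(p <- s) F p = \sum_(p <- t | p \in s) F p.
  rewrite -[RHS]big_filter; apply: perm_big; apply: uniq_perm; rewrite ?filter_uniq //.
  by move=> p; rewrite mem_filter; case: (boolP (p \in s)) => // /st ->.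
rewrite [leRHS](bigID (mem s)) /= lerDl.
by apply: sumr_ge0 => p _; apply: F0.
Qed.

Lemma inv_le_inv (x y : rat) : 0 < x -> x <= y -> y^-1 <= x^-1.
Proof. by move=> x0 xy; rewrite lef_pV2 ?posrE // (lt_le_trans x0). Qed.

Lemma div_cancel_le (b x y : rat) : x != 0 -> b * y^-1 <= b * x / (x * y).
Proof. by move=> x0; rewrite invfM mulrA mulfK. Qed.

Lemma ler_mul_div (x y z d : rat) : 0 < z -> x * z <= y * (z - d) -> x <= y * (1 - d / z).
Proof.
move=> z0 key; rewrite -(ler_pM2r z0); apply: (le_trans key).
by rewrite -[leRHS]mulrA mulrBl mul1r divfK // lt0r_neq0.
Qed.

Lemma scaled_rearrange (q c V th W D K w d : rat) : 0 <= K -> 0 <= q -> 0 <= V -> 0 <= th ->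
  V <= c * th -> 0 <= W -> W <= w / 4 -> d <= 1 - D ->
  48 * K * c * w <= 60 * q * d -> 48 * K * V * W <= 15 * q * th * (1 - D).
Proof.
move=> K0 q0 V0 th0 V_le W0 W_le D_le key.
have c48 : 0 <= 48 :> rat by rewrite ler0n.
have c15 : 0 <= 15 :> rat by rewrite ler0n.
have s1 : 48 * K * V * W <= 48 * K * (c * th) * (w / 4).
  apply: ler_pM.
  - exact: mulr_ge0 (mulr_ge0 c48 K0) V0.
  - exact: W0.
  - exact: ler_wpM2l (mulr_ge0 c48 K0) _ _ V_le.
  - exact: W_le.
apply: (le_trans s1).
have -> : 48 * K * (c * th) * (w / 4) = th * (48 * K * c * w / 4) by field.
have -> : 15 * q * th * (1 - D) = th * (15 * q * (1 - D)) by ring.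
apply: (ler_wpM2l th0); apply: le_trans (_ : 15 * q * d <= _).
  by move: key; clear; lra.
exact: ler_wpM2l (mulr_ge0 c15 q0) _ _ D_le.
Qed.

Lemma sieve_check_sound e m : (4 < m)%N -> (3 %| 2 ^ m - 1)%N ->
  sieve_check e [seq with_order (N.of_nat p) | p <- small_primes] m -> sieve_inequality m.
Proof.
move=> m_gt4 m3; rewrite /sieve_check /sieve_inequality.
have : [/\ (0 < (2 ^ m - 1) %/ 3)%N, ((2 ^ m - 1) %/ 3 * 3 = 2 ^ m - 1)%N &
  ((2 ^ m - 1) %/ 3 < 2 ^ m)%N] by case: (pow2m1_third_facts m_gt4 m3) => *; rewrite divnK.
move: ((2 ^ m - 1) %/ 3)%N => N [N_gt0 NE N_lt].
have m_gt0 : (0 < m)%N by apply: leq_trans m_gt4.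
have primeN p : p \in primes N -> [/\ prime p, odd p, (3 <= p)%N & (p %| 2 ^ m - 1)%N].
  rewrite mem_primes => /and3P[p_pr _ p_dv].
  have p_dv' : (p %| 2 ^ m - 1)%N by rewrite -NE dvdn_mulr.
  by have [] := prime_dvd_pow2m1 m_gt0 p_pr p_dv'.
set n := odd_part m m; have [s sE] := odd_partP m m; rewrite -/n in sE.
have n_gt0 : (0 < n)%N by move: m_gt0; rewrite sE muln_gt0 => /andP[].
set k := factor_count_bound n.
have Fs_le : forall Fs : seq {poly 'F_2}, uniq Fs ->
    (forall f, f \in Fs -> irreducible_poly f /\ f %| 'X^n - 1) -> (size Fs <= k)%N.
  by move=> Fs Fs_uniq Fs_irr; apply: size_irreducible_le.
set c := (if _ then _ else _)%N.
rewrite filter_map -map_comp; set S := filter _ small_primes.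
have -> : [seq (fst \o (fun p => with_order (N.of_nat p))) p | p <- S] = [seq N.of_nat p | p <- S].
  exact: eq_map.
case/andP=> lt0 /ratN_le.
have le0 := proj2 (N.leb_le _ _) (N.lt_le_incl _ _ (proj1 (N.ltb_lt _ _) lt0)).
rewrite !ratNM (ratNB le0); move/ratN_lt: lt0 => {le0}.
rewrite !(ratNM, ratND, ratN_sum, ratN_pow2, ratN_of_nat).
set big := (m %/ 10)%N; set D := (X in X < _); set w := 4%:R + _ + _.
set z : rat := 2 ^+ (e + 10) => D_lt.
have z0 : 0 < z by apply: exprn_gt0.
pose P := [seq p <- primes N | p == 3%N].
pose R := [seq p <- primes N | p != 3%N].
have R_uniq : uniq R by apply/filter_uniq/primes_uniq.
have PR : perm_eq (P ++ R) (primes N) by rewrite perm_filterC.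
pose small r := (r < 5 + 1019)%N.
have small_R : {subset [seq r <- R | small r] <= S}.
  move=> r; rewrite !mem_filter => /and3P[r_small r3 /primeN[r_pr r_odd r_ge r_dv]].
  rewrite inE (maybe_dividesP (prime_gt1 r_pr) r_dv) r_pr mem_iota -/(small r) r_small andbT /=.
  by case: r r3 r_odd r_ge {r_small r_pr r_dv} => [|[|[|[|[|r]]]]].
have S_uniq : uniq S by apply/filter_uniq/filter_uniq/iota_uniq.
have big_R : (count (predC small) R <= big)%N.
  rewrite /big leq_divRL // mulnC; apply: leq_trans (count_large_primes 10 N_gt0 N_lt).
  rewrite leq_mul2l /= count_filter; apply: sub_count => r /= /andP[+ _].
  by rewrite /small -leqNgt.
have split_R (F : nat -> rat) b : (forall p, 0 <= F p) -> (forall r, ~~ small r -> F r <= b) ->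
    0 <= b -> \sum_(r <- R) F r <= \sum_(r <- S) F r + big%:R * b.
  move=> F0 Fb b0; rewrite (bigID small) /=; apply: lerD.
    by rewrite -big_filter; apply: ler_sum_sub => //; apply: filter_uniq.
  apply: le_trans (_ : \sum_(r <- R | ~~ small r) b <= _); first exact: ler_sum.
  rewrite big_const_seq iter_addr_0 -[_ *+ _]mulr_natl. apply: (ler_wpM2r b0).
  by rewrite ler_nat.
have w_ge0 p : 0 <= sieve_weight p by apply/ltW/sieve_weight_gt0.
have W_le : 1 + \sum_(r <- R) sieve_weight r <= w / 4.
  have : \sum_(r <- R) sieve_weight r <= \sum_(r <- S) sieve_weight r + big%:R * 4^-1.
    apply: split_R => // r; rewrite /small -leqNgt /sieve_weight => r_big.
    case: ltnP => [r16|_]; first by have := leq_ltn_trans r_big r16.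
    case: ifP => [r256|_]; last exact: lexx.
    by have := leq_ltn_trans r_big r256.
  have wE : \sum_(p <- S) ratN (weight4 (N.of_nat p)) = 4 * \sum_(p <- S) sieve_weight p.
    by rewrite mulr_sumr; apply: eq_bigr => p _; apply: weight4E.
  rewrite /w wE; move: (\sum_(r <- R) _) (\sum_(r <- S) _) (big%:R).
  by clear; move=> x y b; lra.
have D_le : \sum_(r <- R) r%:R^-1 <= D / z.
  apply: le_trans (_ : \sum_(r <- S) r%:R^-1 + big%:R * (2 ^+ 10)^-1 <= _).
    apply: split_R => [p|r|]; first by rewrite invr_ge0.
      rewrite /small -leqNgt => r_big.
      apply: (inv_le_inv (exprn_gt0 10 (ltr0n _ 2))).
      by rewrite -natrX ler_nat.
    by rewrite invr_ge0; apply/exprn_ge0/ler0n.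
  rewrite /D mulrDl; apply: lerD.
    rewrite mulr_suml !big_seq; apply: ler_sum => r.
    rewrite mem_filter => /andP[_]; rewrite mem_filter => /andP[/prime_gt0 r0 _].
    exact: scaled_inv_ge.
  by rewrite /z exprD; apply: div_cancel_le; apply/expf_neq0/lt0r_neq0/ltr0n.
have D_lt1 : D / z < 1 by rewrite ltr_pdivrMr // mul1r.
have V_th : \prod_(p <- P) (1 + sieve_weight p) <= c%:R * \prod_(p <- P) (1 - p%:R^-1) :> rat.
  rewrite /P; case: (boolP (3%N \in primes N)) => [N3|N3].
    rewrite filter_pred1_uniq ?primes_uniq // !big_seq1.
    have -> : c = 3%N.
      rewrite /c pow2_mod9 //; move: N3; rewrite mem_primes => /and3P[_ _ /dvdnP[q qE]].
      by rewrite -NE qE -mulnA dvdn_mull.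
    by rewrite /sieve_weight /=; clear; lra.
  have -> : [seq p <- primes N | p == 3%N] = [::].
    apply/nilP; rewrite /nilp size_filter -leqn0 leqNgt -has_count.
    apply/negP => /hasP[p pN /eqP p3].
    by move: N3; rewrite -p3 pN.
  by rewrite !big_nil mulr1 /c; case: ifP => _; rewrite ler1n.
move=> key; exists n, s, k, P, R; split; [exact: sE|exact: Fs_le|exact: PR| |].
  exact: le_lt_trans D_le D_lt1.
refine (scaled_rearrange (d := 1 - D / z) (w := w) (c := c%:R) _ _ _ _ V_th _ W_le _ _).
- exact: exprn_ge0.
- exact: exprn_ge0.
- by apply: prodr_ge0 => q _; apply: addr_ge0 ler01 (w_ge0 _).
- rewrite big_seq; apply: prodr_ge0 => q; rewrite mem_filter => /andP[_ /primeN[_ _ q3 _]].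
  exact: one_sub_inv_ge0.
- by apply: addr_ge0 ler01 (sumr_ge0 _ _) => r _; apply: w_ge0.
- by rewrite lerD2l lerN2.
exact: ler_mul_div z0 key.
Qed.

(** Among the even degrees from 32 to 767, sieve_check fails at 36, 42 and 54. *)
Definition middle_degrees : seq nat :=
  [seq m <- iota 32 736 | ~~ odd m && (m \notin [:: 36; 42; 54]%N)].

Lemma middle_degrees_check :
  all (sieve_check 10 [seq with_order (N.of_nat p) | p <- small_primes]) middle_degrees.
Proof. by vm_cast_no_check (erefl true). Qed.

(** * Arithmetic of binary polynomials and certificates *)

Section BitPolynomials.

Variables (R : comNzRingType) (char2 : 2%N \in [pchar R]) (x : R).

Fixpoint pos_eval (p : positive) : R :=
  match p with
  | xH => 1
  | xO q => x * pos_eval q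
  | xI q => x * pos_eval q + 1
  end.

(** The binary digits of n are the coefficients of a polynomial over F_2, which
    is evaluated at x.  Sums of such polynomials are bitwise exclusive or. *)
Definition bit_eval (n : N) : R := if n is Npos p then pos_eval p else 0.

Lemma bit_eval_double n : bit_eval (N.double n) = x * bit_eval n.
Proof. by case: n => [|p] //=; rewrite mulr0. Qed.

Lemma bit_eval_succ_double n : bit_eval (N.succ_double n) = x * bit_eval n + 1.
Proof. by case: n => [|p] //=; rewrite mulr0 add0r. Qed.

Lemma bit_eval_lxor a b : bit_eval (N.lxor a b) = bit_eval a + bit_eval b.
Proof.
have xx (y : R) : y + y = 0 by apply: addrr_pchar2.
case: a b => [|p] [|q] //=; rewrite ?add0r ?addr0 //.
elim: p q => [p IH|p IH|] [q|q|] /=;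
  rewrite ?bit_eval_double ?bit_eval_succ_double ?IH ?mulrDr //=.
- by rewrite addrACA xx addr0.
- by rewrite addrAC.
- by rewrite -addrA xx addr0.
- by rewrite addrA.
- by rewrite addrCA xx addr0.
- by rewrite addrC.
Qed.

Section Modulus.

Variables (m f : N).
Hypothesis f0 : bit_eval f = 0.

(** Multiplication by x, followed by the reduction modulo f, of degree m, that
    keeps the numbers below 2^m.  The value at x is unaffected when
    x is a root of f. *)
Definition bit_shift (c : N) : N :=
  let d := N.double c in if N.testbit d m then N.lxor d f else d.

Fixpoint pos_mul (p : positive) (b : N) : N :=
  match p with
  | xH => b
  | xO q => bit_shift (pos_mul q b)
  | xI q => N.lxor (bit_shift (pos_mul q b)) b
  end.

Definition bit_mul (a b : N) : N := if a is Npos p then pos_mul p b else 0%num.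

Fixpoint pos_exp (b : N) (e : positive) : N :=
  match e with
  | xH => b
  | xO e' => let c := pos_exp b e' in bit_mul c c
  | xI e' => let c := pos_exp b e' in bit_mul (bit_mul c c) b
  end.

Definition bit_exp (b e : N) : N := if e is Npos p then pos_exp b p else 1%num.

Fixpoint bit_tr (k : nat) (b : N) : N :=
  if k is k'.+1 then N.lxor b (bit_tr k' (bit_mul b b)) else 0%num.

Lemma bit_eval_shift c : bit_eval (bit_shift c) = x * bit_eval c.
Proof.
by rewrite /bit_shift; case: ifP => _; rewrite ?bit_eval_lxor bit_eval_double ?f0 ?addr0.
Qed.

Lemma bit_eval_mul a b : bit_eval (bit_mul a b) = bit_eval a * bit_eval b.
Proof.
case: a => [|p] /=; first by rewrite mul0r.
elim: p => [p IH|p IH|] /=; rewrite ?bit_eval_lxor ?bit_eval_shift ?IH ?mul1r //.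
  by rewrite mulrDl mul1r mulrA.
by rewrite mulrA.
Qed.

Lemma bit_eval_exp b e : bit_eval (bit_exp b e) = bit_eval b ^+ N.to_nat e.
Proof.
case: e => [|e] //=; elim: e => [e IH|e IH|] //=; rewrite !bit_eval_mul !IH.
  have -> : Pos.to_nat e~1 = (Pos.to_nat e * 2).+1 by lia.
  by rewrite exprSr exprM expr2.
have -> : Pos.to_nat e~0 = (Pos.to_nat e * 2)%N by lia.
by rewrite exprM expr2.
Qed.

Lemma bit_eval_tr k b : bit_eval (bit_tr k b) = \sum_(i < k) bit_eval b ^+ (2 ^ i).
Proof.
elim: k b => [|k IH] b /=; first by rewrite big_ord0.
rewrite bit_eval_lxor IH big_ord_recl expr1; congr (_ + _); apply: eq_bigr => i _.
by rewrite bit_eval_mul -expr2 -exprM -expnS.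
Qed.

End Modulus.

End BitPolynomials.

Lemma to_nat_div a b : b <> 0%num -> N.to_nat (N.div a b) = (N.to_nat a %/ N.to_nat b)%N.
Proof.
move=> b0; have E := N.Div0.div_mod a b; have lt := N.mod_lt a b b0.
move: (N.modulo a b) (N.div a b) E lt => r q -> lt.
rewrite N2Nat.inj_add N2Nat.inj_mul.
have -> : forall x y z : nat, ((x * y)%coq_nat + z)%coq_nat = (y * x + z)%N by move=> *; lia.
by rewrite divnMDl ?divn_small ?addn0 //; lia.
Qed.

Definition trial_prime (p : N) : bool :=
  N.ltb 1 p && all (fun d => ~~ N.eqb (N.modulo p (N.of_nat d)) 0)
                 (iota 2 (N.to_nat (N.sqrt p)).-1).

Lemma trial_primeP p : trial_prime p -> prime (N.to_nat p).
Proof.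
case/andP=> /N.ltb_lt p1 /allP ndiv; apply: ltn_pdiv2_prime; first by lia.
rewrite ltnNge; apply/negP => le_p; set d := pdiv (N.to_nat p) in le_p.
have d_pr : prime d by apply: pdiv_prime; lia.
have d_gt1 := prime_gt1 d_pr.
have d_le : (d <= N.to_nat (N.sqrt p))%N.
  rewrite leqNgt; apply/negP => lt_d.
  have [_] := N.sqrt_spec p (N.le_0_l p); nia.
have := ndiv d; rewrite mem_iota => H.
have : ~~ N.eqb (N.modulo p (N.of_nat d)) 0 by apply: H; lia.
move/negP; apply; apply/N.eqb_spec/N2Nat.inj; rewrite to_nat_mod ?Nat2N.id; last by lia.
by apply/eqP; apply: pdiv_dvd.
Qed.

Definition prod_powers (ps : seq (N * nat)) : N :=
  foldr (fun pe acc => N.mul (N.pow pe.1 (N.of_nat pe.2)) acc) 1%num ps.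

Lemma prime_dvd_prod_powers ps q : prime q ->
  all (fun pe => trial_prime pe.1) ps -> (q %| N.to_nat (prod_powers ps))%N ->
  exists2 p, p \in [seq pe.1 | pe <- ps] & q = N.to_nat p.
Proof.
move=> q_pr; elim: ps => [|[p e] ps IH] /=; first by rewrite dvdn1 => _ /eqP q1; rewrite q1 in q_pr.
case/andP=> /trial_primeP p_pr /IH{}IH.
have -> : N.to_nat (N.mul (N.pow p (N.of_nat e)) (prod_powers ps)) =
    (N.to_nat p ^ e * N.to_nat (prod_powers ps))%N.
  rewrite N2Nat.inj_mul; congr (_ * _)%N.
  by elim: (e) => // k IHk; rewrite Nat2N.inj_succ N.pow_succ_r' N2Nat.inj_mul IHk expnS.
rewrite Euclid_dvdM // => /orP[|/IH[r rps ->]]; last by exists r; rewrite // inE rps orbT.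
rewrite Euclid_dvdX // => /andP[qp _]; exists p; first exact: mem_head.
by apply/eqP; rewrite -dvdn_prime2.
Qed.

(** It is verified that a root x of f satisfies x^(2^m - 1) = 1, which makes f
    have a root in the field with 2^m elements, then that x has order n: the
    product of the x^(n/p) - 1 is nonzero because some power of it is 1.  The
    traces of x and 1/x are computed, and zeta witnesses that x is 1-normal, see
    one_normal_of_dual. *)
Definition certificate_check (m : nat) (a : bool) (f zeta : N) (ps : seq (N * nat)) : bool :=
  let M := N.of_nat m in
  let mul := bit_mul M f in
  let exp := bit_exp M f in
  let tr := bit_tr M f m in
  let Q1 := N.sub (N.pow 2 M) 1 in
  let n := N.div Q1 3 in
  [&& N.ltb 1 f, all (fun pe => trial_prime pe.1) ps, N.eqb (prod_powers ps) n,
      N.eqb (exp 2%num Q1) 1, N.eqb (exp 2%num n) 1,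
      N.eqb (exp (foldr (fun pe acc => mul (N.lxor (exp 2%num (N.div n pe.1)) 1) acc) 1%num ps) Q1) 1,
      N.eqb (tr 2%num) 0,
      N.eqb (tr (exp 2%num (N.sub n 1))) (if a then 1%num else 0%num) &
      all (fun i => N.eqb (tr (mul zeta (exp 2%num (N.pow 2 (N.of_nat i)))))
                      (if (i < 2)%N then 1%num else 0%num)) (iota 0 m)].

(** Entries (m, a, f, zeta, factorization of (2^m - 1) / 3), where f has
    degree m. *)
Definition certificates : seq (nat * bool * N * N * seq (N * nat)) := ([::
  (20, false, 1049061%num, 903832%num,
    [:: (5%num, 2); (11%num, 1); (31%num, 1); (41%num, 1)]);
  (20, true, 1051187%num, 219572%num,
    [:: (5%num, 2); (11%num, 1); (31%num, 1); (41%num, 1)]);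
  (22, false, 4194405%num, 510028%num,
    [:: (23%num, 1); (89%num, 1); (683%num, 1)]);
  (22, true, 4194443%num, 687734%num,
    [:: (23%num, 1); (89%num, 1); (683%num, 1)]);
  (24, false, 16777685%num, 13094322%num,
    [:: (3%num, 1); (5%num, 1); (7%num, 1); (13%num, 1); (17%num, 1); (241%num, 1)]);
  (24, true, 16778927%num, 790322%num,
    [:: (3%num, 1); (5%num, 1); (7%num, 1); (13%num, 1); (17%num, 1); (241%num, 1)]);
  (26, false, 67109797%num, 21377856%num,
    [:: (2731%num, 1); (8191%num, 1)]);
  (26, true, 67109099%num, 50561372%num,
    [:: (2731%num, 1); (8191%num, 1)]);
  (28, false, 268436309%num, 223297906%num,
    [:: (5%num, 1); (29%num, 1); (43%num, 1); (113%num, 1); (127%num, 1)]);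
  (28, true, 268436443%num, 103444080%num,
    [:: (5%num, 1); (29%num, 1); (43%num, 1); (113%num, 1); (127%num, 1)]);
  (30, false, 1073743081%num, 1000589776%num,
    [:: (3%num, 1); (7%num, 1); (11%num, 1); (31%num, 1); (151%num, 1); (331%num, 1)]);
  (30, true, 1073742059%num, 598474706%num,
    [:: (3%num, 1); (7%num, 1); (11%num, 1); (31%num, 1); (151%num, 1); (331%num, 1)]);
  (36, false, 68719476945%num, 56791012570%num,
    [:: (3%num, 2); (5%num, 1); (7%num, 1); (13%num, 1); (19%num, 1); (37%num, 1); (73%num, 1); (109%num, 1)]);
  (36, true, 68720118491%num, 6811329526%num,
    [:: (3%num, 2); (5%num, 1); (7%num, 1); (13%num, 1); (19%num, 1); (37%num, 1); (73%num, 1); (109%num, 1)]);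
  (42, false, 4398046512021%num, 4246557558932%num,
    [:: (3%num, 1); (7%num, 2); (43%num, 1); (127%num, 1); (337%num, 1); (5419%num, 1)]);
  (42, true, 4398046626167%num, 2029613348222%num,
    [:: (3%num, 1); (7%num, 2); (43%num, 1); (127%num, 1); (337%num, 1); (5419%num, 1)]);
  (54, false, 18014398509482205%num, 1615769625584016%num,
    [:: (3%num, 3); (7%num, 1); (19%num, 1); (73%num, 1); (87211%num, 1); (262657%num, 1)]);
  (54, true, 18014398509486975%num, 16170281194467294%num,
    [:: (3%num, 3); (7%num, 1); (19%num, 1); (73%num, 1); (87211%num, 1); (262657%num, 1)])
])%N.

Lemma certificates_check :
  all (fun c => let: (m, a, f, z, ps) := c in certificate_check m a f z ps) certificates.
Proof. by vm_cast_no_check (erefl true). Qed.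

(** * Correctness of the certificates *)

Lemma map_bit_eval (L : fieldExtType 'F_2) (z : L) n :
  (map_poly (in_alg L) (bit_eval 'X n)).[z] = bit_eval z n.
Proof.
case: n => [|p] /=; first by rewrite rmorph0 horner0.
elim: p => [p IH|p IH|] /=; last by rewrite rmorph1 hornerC.
  by rewrite rmorphD rmorphM rmorph1 /= map_polyX !hornerE IH.
by rewrite rmorphM /= map_polyX !hornerE IH.
Qed.

Lemma size_bit_eval_gt1 n : N.ltb 1 n -> (1 < size (bit_eval ('X : {poly 'F_2}) n))%N.
Proof.
have gt0 p : (0 < size (pos_eval ('X : {poly 'F_2}) p))%N.
  elim: p => [p IH|p IH|] /=; last by rewrite size_poly1.
    by rewrite mulrC -[1]/(1%:P) size_MXaddC oner_eq0 andbF.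
  by rewrite mulrC size_mulX // -size_poly_gt0.
case: n => [|[p|p|]] //= _; have := gt0 p.
  by rewrite mulrC -[1]/(1%:P) size_MXaddC oner_eq0 andbF.
by move=> p0; rewrite mulrC size_mulX -?size_poly_gt0.
Qed.

Section Roots.

Variable L : splittingFieldType 'F_2.
Local Notation K := (finvect_type L).
Local Notation m := (\dim {: L}).

(** X^(2^m) - X is the product of all X - x, so each of its irreducible
    factors has a root. *)
Lemma irreducible_root (f : {poly 'F_2}) : irreducible_poly f ->
  f %| 'X^(2 ^ m) - 'X -> exists x : K, root (map_poly (in_alg K) f) x.
Proof.
move=> f_irr f_dv.
have : map_poly (in_alg K) f %| \prod_(x <- enum K) ('X - x%:P).
  rewrite big_enum /= -finField_genPoly card_finvect.
  have -> : 'X^(2 ^ m) - 'X = map_poly (in_alg K) ('X^(2 ^ m) - 'X) :> {poly K}.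
    by rewrite rmorphB /= map_polyXn map_polyX.
  by rewrite dvdp_map.
case/dvdp_prod_XsubC => b.
case: (mask b (enum K)) => [|x s].
  rewrite big_nil => /eqp_size; rewrite size_poly1 size_map_poly.
  by have [+ _] := f_irr => f1 s1; rewrite s1 in f1.
rewrite big_cons => /eqp_root/(_ x) E; exists x.
by rewrite E rootM root_XsubC eqxx.
Qed.


(** The test is run in the extension generated by a root z of an irreducible
    factor of f; it gives z^(2^m) = z, so that factor divides X^(2^m) - X. *)
Lemma bit_eval_root (f : N) : N.ltb 1 f ->
    bit_exp (N.of_nat m) f 2 (N.sub (N.pow 2 (N.of_nat m)) 1) = 1%num ->
  exists x : K, bit_eval x f = 0.
Proof.
move=> f1 f_exp; have [g g_irr gf] := irreducible_factor (size_bit_eval_gt1 f1).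
have [L' _ [z gz _]] := irredp_FAdjoin g_irr.
have p2 : 2%N \in [pchar L'] by rewrite (pchar_lalg L') pchar_Fp.
have rootF (M : fieldExtType 'F_2) (y : M) :
    root (map_poly (in_alg M) g) y -> bit_eval y f = 0.
  move=> gy; rewrite -map_bit_eval; apply/eqP; rewrite -/(root _ y).
  by have [u ->] := dvdpP _ _ gf; rewrite rmorphM rootM gy orbT.
have zf := rootF _ z gz.
have z1 : z ^+ (2 ^ m - 1) = 1.
  have := bit_eval_exp p2 (N.of_nat m) zf 2 (N.sub (N.pow 2 (N.of_nat m)) 1).
  rewrite f_exp N2Nat.inj_sub to_nat_pow2 /= mulr1 => ->.
  by congr (_ ^+ _).
have [|x gx] := irreducible_root g_irr; last by exists x; apply: rootF.
apply: (irreducible_dvd_root g_irr gz).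
rewrite rmorphB /= map_polyXn map_polyX rootE !hornerE subr_eq0.
have -> : (2 ^ m = (2 ^ m - 1).+1)%N by rewrite subn1 prednK ?expn_gt0.
by rewrite exprS z1 mulr1.
Qed.

End Roots.

Section CertificateSoundness.

Variable L : splittingFieldType 'F_2.
Local Notation K := (finvect_type L).
Local Notation m := (\dim {: L}).
Local Notation cardK := (card_finvect L).

(** If sum g_i x^(2^i) = 0 with deg g <= m - 2, pairing it with z^(2^j) for
    j <= m - 2 gives g_j + g_(j+1) = 0; as g_(m-1) = 0, all coefficients vanish.
    Such a z exists for every 1-normal x of trace 0: the vector (1, 1, 0, ..., 0) is
    orthogonal to the only relation among the conjugates, that they sum to 0. *)
Lemma one_normal_of_dual (x z : K) : tr m x = 0 ->
  (forall i, (i < m)%N -> tr m (z * x ^+ (2 ^ i)) = (i < 2)%N%:R) -> k_normal 1 (x : L).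
Proof.
move=> x0 dual; apply: one_normal_of_free => // g lt_g g0.
have trZ c (y : K) : tr m (c *: y) = c *: tr m y.
  by case: (F2_cases c) => ->; rewrite ?scale0r ?tr0 ?scale1r.
have step j : (j.+1 < m)%N -> g`_j + g`_j.+1 = 0.
  move=> lt_j; have : tr m (z ^+ (2 ^ j) * frob_act g x) = 0 by rewrite g0 mulr0 tr0.
  rewrite (@frob_act_widen _ m) ?(ltnW lt_g) // mulr_sumr.
  rewrite (big_morph (tr m) (trD cardK) (tr0 K m)).
  have tr_shift (i : 'I_m) : tr m (z ^+ (2 ^ j) * (g`_i *: x ^+ (2 ^ i))) =
      g`_i *: ((i == j :> nat) || (i == j.+1 :> nat))%:R.
    rewrite -scalerAr trZ; congr (_ *: _).
    have [le_ji|lt_ij] := leqP j i.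
      have -> : z ^+ (2 ^ j) * x ^+ (2 ^ i) = (z * x ^+ (2 ^ (i - j))) ^+ (2 ^ j).
        by rewrite exprMn -exprM -expnD subnK.
      rewrite (tr_frobX cardK) dual; last by apply: leq_ltn_trans (leq_subr _ _) (ltn_ord i).
      congr (nat_of_bool _)%:R; move: (i : nat) le_ji => i' le_ji.
      by apply/idP/idP; lia.
    have -> : z ^+ (2 ^ j) * x ^+ (2 ^ i) = (z * x ^+ (2 ^ (m - j + i))) ^+ (2 ^ j).
      rewrite exprMn -exprM -expnD -addnA (addnC i) addnA subnK; last by rewrite ltnW // ltnW.
      by rewrite expnD exprM (expf_card_pow2 cardK).
    rewrite (tr_frobX cardK) dual; last first.
      move: (m) (i : nat) lt_j lt_ij => m' i' lt_j lt_ij; lia.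
    congr (nat_of_bool _)%:R.
    by move: (m) (i : nat) lt_j lt_ij => m' i' lt_j lt_ij; apply/idP/idP; lia.
  rewrite (eq_bigr _ (fun i _ => tr_shift i)).
  rewrite (bigD1 (Ordinal (ltnW lt_j))) //= eqxx /= (bigD1 (Ordinal lt_j)) /=; last first.
    by rewrite -val_eqE /= gtn_eqF.
  rewrite eqxx orbT big1 ?addr0; last first.
    move=> i /andP[/negPf ij /negPf ij1].
    by move: ij ij1; rewrite -!val_eqE /= => -> ->; rewrite scaler0.
  by rewrite -scalerDl => /eqP; rewrite scaler_eq0 oner_eq0 orbF => /eqP.
have zero k : g`_(m.-1 - k) = 0.
  elim: k => [|k IH].
    by rewrite nth_default // subn0 -ltnS prednK // (card_pow2_exp_gt0 cardK).
  have [le_k|lt_k] := leqP m.-1 k.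
    have z0 : (m.-1 - k = 0)%N by apply/eqP; rewrite subn_eq0.
    have z1 : (m.-1 - k.+1 = 0)%N by apply/eqP; rewrite subn_eq0 ltnW.
    by move: IH; rewrite z0 z1.
  have := step (m.-1 - k.+1)%N; rewrite subnSK // IH addr0; apply.
  by rewrite -[X in (_ < X)%N](prednK (card_pow2_exp_gt0 cardK)) ltnS leq_subr.
apply/polyP => i; rewrite coef0; have [lt_i|le_i] := ltnP i m.
  have := zero (m.-1 - i)%N; rewrite subKn //.
  by rewrite -ltnS prednK // (card_pow2_exp_gt0 cardK).
by rewrite nth_default // (leq_trans (ltnW lt_g)).
Qed.

Lemma certificate_good (c : bool) f zeta ps : (4 < m)%N -> (3 %| 2 ^ m - 1)%N ->
  certificate_check m c f zeta ps -> exists x : K, prescribed_element c x.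
Proof.
move=> m_gt4 m3; rewrite /certificate_check.
set Q1 := N.sub _ 1; set n := N.div Q1 3.
have [N_gt0 N_dv _ _ _] := pow2m1_third_facts m_gt4 m3.
have Q1E : N.to_nat Q1 = (2 ^ m - 1)%N by rewrite N2Nat.inj_sub to_nat_pow2.
have nE : N.to_nat n = ((2 ^ m - 1) %/ 3)%N by rewrite to_nat_div // Q1E.
rewrite -nE in N_gt0 N_dv.
case/and5P=> f1 ps_prime /N.eqb_spec ps_n /N.eqb_spec f_exp.
case/and5P=> /N.eqb_spec n_exp /N.eqb_spec ps_exp /N.eqb_spec tr_x /N.eqb_spec tr_inv /allP dual.
have [x xf] := bit_eval_root f1 f_exp.
have p2 : 2%N \in [pchar K] := card_pow2_pchar cardK.
have evX : bit_eval x 2 = x by rewrite /= mulr1.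
have evE := bit_eval_exp p2 (N.of_nat m) xf.
have evM := bit_eval_mul p2 (N.of_nat m) xf.
have evT b : bit_eval x (bit_tr (N.of_nat m) f m b) = tr m (bit_eval x b).
  exact: (bit_eval_tr p2 (N.of_nat m) xf).
have xQ : x ^+ (2 ^ m - 1) = 1 by rewrite -Q1E -{1}evX -evE f_exp.
have xN : x ^+ N.to_nat n = 1 by rewrite -{1}evX -evE n_exp.
have x0 : x != 0.
  apply: contra_eq_neq xN => ->.
  by rewrite expr0n eqn0Ngt N_gt0 eq_sym oner_eq0.
exists x; split.
- rewrite -nE; apply: prim_root_of_primes => // q qN.
  have [q_pr q_dv] : prime q /\ (q %| N.to_nat n)%N.
    by move: qN; rewrite mem_primes => /and3P[].
  have [p p_ps qE] : exists2 p, p \in [seq pe.1 | pe <- ps] & q = N.to_nat p.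
    by apply: (prime_dvd_prod_powers q_pr ps_prime); rewrite ps_n.
  set w := foldr _ _ _ in ps_exp.
  have w0 : bit_eval x w != 0.
    have : bit_eval x w ^+ N.to_nat Q1 = 1 by rewrite -evE ps_exp.
    apply: contra_eq_neq => ->; rewrite expr0n eqn0Ngt.
    rewrite Q1E (leq_trans _ (dvdn_leq _ N_dv)) //.
      by rewrite eq_sym oner_eq0.
    by rewrite -Q1E lt0n; apply/eqP => Q0; move: N_gt0; rewrite nE -Q1E Q0 div0n.
  have : bit_eval x (N.lxor (bit_exp (N.of_nat m) f 2 (N.div n p)) 1) != 0.
    move: w0; rewrite /w; elim: (ps) p_ps => //= -[p' e'] ps' IH.
    rewrite inE evM mulf_eq0 negb_or => /orP[/eqP->|/IH{}IH] /andP[w1 w2] //.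
    exact: IH.
  rewrite (bit_eval_lxor p2) evE evX to_nat_div; last first.
    by move=> p0; move: q_pr; rewrite qE p0.
  by rewrite -qE addr_eq0 (oppx2 cardK).
- apply: (@one_normal_of_dual x (bit_eval x zeta)).
    by have := evT 2%num; rewrite tr_x evX.
  move=> i lt_i; have := dual i; rewrite mem_iota lt_i => /(_ isT)/N.eqb_spec E.
  have := evT (bit_mul (N.of_nat m) f zeta (bit_exp (N.of_nat m) f 2 (N.pow 2 (N.of_nat i)))).
  by rewrite E evM evE evX to_nat_pow2 => <-; case: ifP.
- have := evT (bit_exp (N.of_nat m) f 2 (N.sub n 1)); rewrite tr_inv evE evX => E.
  have -> : x^-1 = x ^+ N.to_nat (N.sub n 1).
    apply: (mulfI x0); rewrite mulfV // -exprS N2Nat.inj_sub.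
    by rewrite -[(_ - N.to_nat 1)%coq_nat]/(N.to_nat n - 1)%N subn1 prednK.
  by rewrite -E; case: (c).
Qed.

End CertificateSoundness.

(** * Trace, norm and conclusion *)

Lemma big_cycle_expg (R : nmodType) (gT : finGroupType) (g : gT) (F : gT -> R) :
  \sum_(x in <[g]>%g) F x = \sum_(i < #[g]%g) F (g ^+ i)%g.
Proof.
have inj : {in [set: 'I_#[g]%g] &, injective (fun i : 'I_#[g]%g => (g ^+ i)%g)}.
  move=> i j _ _ /eqP; rewrite eq_expg_mod_order !modn_small // => /eqP.
  exact: val_inj.
have -> : \sum_(i < #[g]%g) F (g ^+ i)%g = \sum_(i in [set: 'I_#[g]%g]) F (g ^+ i)%g.
  by apply: eq_bigl => i; rewrite inE.
rewrite -(big_imset F inj); apply: eq_bigl => x.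
apply/idP/imsetP => [/cyclePmin[i lt_i ->]|[i _ ->]]; last exact: mem_cycle.
by exists (Ordinal lt_i).
Qed.

Section TraceNorm.

Variable L : splittingFieldType 'F_2.
Local Notation K := (finvect_type L).
Local Notation m := (\dim {: L}).

(** The Galois group is cyclic of order m, generated by the Frobenius map. *)
Lemma Tr_frobenius (x : L) : Tr x = tr m (x : K).
Proof.
have [al al_gen al_frob] := finField_galois_generator (sub1v {: L}%AS).
have dim_gal : #[al]%g = m.
  rewrite /order -(eqP al_gen) -(galois_dim (finField_galois (sub1v {: L}%AS))).
  by rewrite dimv1 divn1.
rewrite /Tr /galTrace (eqP al_gen) big_cycle_expg dim_gal; apply: eq_bigr => i _.
elim: (i : nat) => [|k IH]; first by rewrite expg0 gal_id expr1.
rewrite expgSr galM ?memvf // IH al_frob ?memvf //.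
by rewrite dimv1 card_Fp // expn1 -exprM -expnSr.
Qed.

Lemma Nm_eq1 (x : L) : x != 0 -> Nm x = 1.
Proof.
move=> x0; have := mem_galNorm (finField_galois (sub1v {: L}%AS)) (memvf x).
case/vlineP => c; rewrite -/(Nm x) => NmE.
have : Nm x != 0 by rewrite /Nm galNorm_eq0.
by rewrite NmE; case: (F2_cases c) => ->; rewrite ?scale0r ?eqxx ?scale1r.
Qed.

End TraceNorm.

Lemma certificates_complete m c : m \in [:: 20; 22; 24; 26; 28; 30; 36; 42; 54]%N ->
  exists f zeta ps, certificate_check m c f zeta ps.
Proof.
move=> m_in.
pose key (t : nat * bool * N * N * seq (N * nat)) := (t.1.1.1.1, t.1.1.1.2).
have : (m, c) \in map key certificates.
  move: m_in; rewrite !inE; case: c => m_in.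
    by do 8 (case/orP: m_in => [/eqP-> //|m_in]); move/eqP: m_in => ->.
  by do 8 (case/orP: m_in => [/eqP-> //|m_in]); move/eqP: m_in => ->.
case/mapP => -[[[[m' a] f] z] ps] t_in [-> ->].
by exists f, z, ps; have := allP certificates_check _ t_in.
Qed.

Lemma three_dvd_even m : (3 %| 2 ^ m - 1)%N -> ~~ odd m.
Proof.
move=> m3; apply/negP => m_odd.
have : (2 ^ m == 1 %[mod 3])%N by rewrite eqn_mod_dvd ?expn_gt0.
rewrite -(odd_double_half m) m_odd expnD expn1 -mul2n expnM -modnMmr -modnXm.
by rewrite -[((2 ^ 2) %% 3)%N]/1%N exp1n.
Qed.

Lemma exists_prescribed_element (L : splittingFieldType 'F_2) (c : bool) :
  (20 <= \dim {: L})%N -> (3 %| 2 ^ \dim {: L} - 1)%N ->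
  exists x : finvect_type L, prescribed_element c x.
Proof.
move=> m20 m3; have m_even := three_dvd_even m3.
have m_gt4 : (4 < \dim {: L})%N by apply: leq_trans m20.
have [m_large|m_small] := leqP 768 (\dim {: L}).
  exact: sieve_criterion m_gt4 m3 (large_sieve_inequality m_large m_even m3).
have [m_cert|m_ncert] := boolP (\dim {: L} \in [:: 20; 22; 24; 26; 28; 30; 36; 42; 54]%N).
  have [f [z [ps cert]]] := certificates_complete c m_cert.
  exact: certificate_good m_gt4 m3 cert.
have m_mid : \dim {: L} \in middle_degrees.
  rewrite mem_filter m_even mem_iota; move: m20 m_small m_even m_ncert {m3 m_gt4}.
  rewrite !inE; move: (\dim _) => m m20 m_small m_even m_ncert; lia.
have := allP middle_degrees_check _ m_mid => chk.
exact: sieve_criterion m_gt4 m3 (sieve_check_sound m_gt4 m3 chk).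
Qed.

Theorem lemma4p5 (m : nat) (hm : (7 <= m)%N) (h3 : (3 %| 2 ^ m - 1)%N)
    (hm' : m \notin [:: 8; 10; 12; 14; 16; 18]%N)
    (L : splittingFieldType 'F_2) (hL : \dim {:L} = m)
    (a b : 'F_2) (hb : b = 1) :
  exists xi : L,
    [/\ r_primitive 3 xi, k_normal 1 xi,
        Tr xi^-1 = (a / b)%:A & Nm xi = b%:A].
Proof.
have m_even := three_dvd_even h3.
have m20 : (20 <= m)%N by move: hm hm' m_even; clear; rewrite !inE; lia.
rewrite -hL in h3 m20.
have [x [x_prim x_normal x_tr]] := exists_prescribed_element (a == 1) m20 h3.
exists x; split.
- by rewrite /r_primitive card_Fp // h3.
- exact: x_normal.
- rewrite Tr_frobenius x_tr hb divr1.
  by case: (F2_cases a) => ->; rewrite ?eqxx ?scale1r ?scale0r // eq_sym oner_eq0.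
- rewrite hb scale1r; apply: Nm_eq1.
  have N_gt0 := prim_order_gt0 x_prim.
  have := prim_expr_order x_prim; apply: contra_eq_neq => ->.
  by rewrite expr0n eqn0Ngt N_gt0 eq_sym oner_eq0.
Qed.
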